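(* Let $\Lambda$ be an $A$-lattice of rank $n$ and let $r>0$. Then for all integers $i\gg0$ $$\#\{\lambda\in\Lambda:\|\lambda\|\leqslant rc^i\}=\frac{c^{ni}}{\operatorname{vol}_r(\Lambda)},$$ and for all integers $i$ $$\#\{\lambda\in\Lambda:\|\lambda\|\leqslant rc^i\}\geqslant\frac{c^{ni}}{\operatorname{vol}_r(\Lambda)}.$$
   Context: $F$ global function field, $\infty$ a place, $A\subset F$ the ring of elements regular outside $\infty$, $F_\infty$ the completion with residue field of cardinality $c$, $|\cdot|_\infty$ normalized by $|\pi|_\infty=c^{-1}$. An $A$-lattice is a finitely generated projective $A$-module $\Lambda$ with $\|\cdot\|\colon\Lambda\to\mathbb{R}_{\geqslant0}$ vanishing only at $0$, ultrametric, satisfying $\|a\lambda\|=|a|_\infty\|\lambda\|$ for $a\in A$, with $\{\lambda:\|\lambda\|\leqslant r\}$ finite for all $r$. The norm extends uniquely to an $\infty$-adic norm on $V_\infty=F_\infty\otimes_A\Lambda$, inducing its canonical topology. The $r$-normalized volume is $\operatorname{vol}_r(\Lambda)=\mu(V_\infty/\Lambda)$, where $\mu$ is the translation-invariant Haar measure on $V_\infty$ with $\mu(\{v\in V_\infty:\|v\|\leqslant r\})=1$. *)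

(* Defs.v *)
From HB Require Import structures.
From mathcomp Require Import all_boot all_order all_algebra all_field.
From mathcomp Require Import finmap.
From mathcomp Require Import all_classical all_reals all_analysis.

Set Implicit Arguments.
Unset Strict Implicit.
Unset Printing Implicit Defensive.

Import Order.TTheory GRing.Theory Num.Theory.
Local Open Scope classical_set_scope.
Local Open Scope ring_scope.

(** Normalized discrete valuations, i.e. valuations with value group [int].
    The value at 0 should be [+oo]; the junk value 0 is imposed there, so that
    equal valuations are equal as functions.  The places of a global function
    field are exactly its normalized discrete valuations (a valuation of such
    a field is trivial on the finite field of constants). *)
Record dvaluation (K : fieldType) := DValuation {
  dval :> K -> int ;
  dval0 : dval 0 = 0 ;
  dvalM : forall x y, x != 0 -> y != 0 -> dval (x * y) = dval x + dval y ;
  dvalD : forall x y, x != 0 -> y != 0 -> x + y != 0 ->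
            Num.min (dval x) (dval y) <= dval (x + y) ;
  dval_uniformizer : exists x, dval x = 1 }.

(** [vge v m x] is [v x >= m] with the convention [v 0 = +oo]. *)
Definition vge (K : fieldType) (v : dvaluation K) (m : int) (x : K) : Prop :=
  x = 0 \/ m <= v x.

Section DValuationTheory.
Variables (K : fieldType) (v : dvaluation K).

Lemma dval1 : v 1 = 0.
Proof.
apply: (addrI (v 1)); rewrite addr0.
by rewrite -dvalM ?oner_neq0// mulr1.
Qed.

Lemma dvalN x : v (- x) = v x.
Proof.
have N1 : (- 1 : K) != 0 by rewrite oppr_eq0 oner_neq0.
have vN1 : v (- 1) = 0.
  have /eqP := dvalM v N1 N1.
  by rewrite mulrNN mulr1 dval1 -mulr2n eq_sym mulrn_eq0/= => /eqP.
have [->|x0] := eqVneq x 0; first by rewrite oppr0.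
by rewrite -mulN1r dvalM// vN1 add0r.
Qed.

Lemma vge1 : vge v 0 1.
Proof. by right; rewrite dval1. Qed.

Lemma vgeB m x y : vge v m x -> vge v m y -> vge v m (x - y).
Proof.
move=> [->|hx]; first by rewrite sub0r => -[->|hy];
  [left; rewrite oppr0|right; rewrite dvalN].
move=> [->|hy]; first by rewrite subr0; right.
have [x0|x0] := eqVneq x 0.
  by rewrite x0 sub0r; right; rewrite dvalN.
have [y0|y0] := eqVneq y 0; first by rewrite y0 subr0; right.
have [->|xy0] := eqVneq (x - y) 0; [by left|right].
have yN0 : - y != 0 by rewrite oppr_eq0.
apply: le_trans (dvalD v x0 yN0 xy0).
by rewrite le_min hx dvalN hy.
Qed.

Lemma vge0M x y : vge v 0 x -> vge v 0 y -> vge v 0 (x * y).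
Proof.
move=> [->|hx]; first by rewrite mul0r; left.
move=> [->|hy]; first by rewrite mulr0; left.
have [->|x0] := eqVneq x 0; first by rewrite mul0r; left.
have [->|y0] := eqVneq y 0; first by rewrite mulr0; left.
by right; rewrite dvalM// addr_ge0.
Qed.

End DValuationTheory.

(** The residue classes [x + m_v], for [x] in the valuation ring of [v], with
    [m_v] its maximal ideal. *)
Definition residue_field (K : fieldType) (v : dvaluation K) : set (set K) :=
  [set [set y | vge v 1 (y - x)] | x in [set x | vge v 0 x]].

(** This is 0 if the residue field is infinite, which does not occur for places
    of global function fields and their completions. *)
Definition residue_card (K : fieldType) (v : dvaluation K) : nat :=
  #|` fset_set (residue_field v)|.

Definition vabs (R : realType) (K : fieldType) (v : dvaluation K) (x : K) : R :=
  if x == 0 then 0 else (residue_card v)%:R ^ (- v x).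

(** [Kv], with the valuation [w], is the completion of [K] at [v] along
    [iota]: [w] extends [v], the image of [K] is dense, and Cauchy sequences
    converge.  Phrased with valuations, since [vabs] takes the finiteness of
    the residue field of [w] for granted. *)
Definition is_completion (K : fieldType) (v : dvaluation K)
    (Kv : fieldType) (w : dvaluation Kv) (iota : {rmorphism K -> Kv}) : Prop :=
  [/\ forall x, w (iota x) = v x,
      forall (x : Kv) (m : int), exists y : K, vge w m (x - iota y) &
      forall u : nat -> Kv,
        (forall m : int, exists N : nat, forall p q : nat,
           (N <= p)%N -> (N <= q)%N -> vge w m (u p - u q)) ->
        exists l : Kv, forall m : int, exists N : nat, forall p : nat,
           (N <= p)%N -> vge w m (u p - l)].

(** Elements of [F] regular at all places other than [v]. *)
Definition regular_outside (F : fieldType) (v : dvaluation F) : F -> bool :=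
  fun x => `[< forall w : dvaluation F, (w : F -> int) <> v -> vge w 0 x >].

Section RegularRing.
Variables (F : fieldType) (v : dvaluation F).

Lemma regular_outside_subring : subring_closed (regular_outside v).
Proof.
split=> [|x y /asboolP hx /asboolP hy|x y /asboolP hx /asboolP hy];
  apply/asboolP => w hw.
- exact: vge1.
- by apply: vgeB; [exact: hx|exact: hy].
- by apply: vge0M; [exact: hx|exact: hy].
Qed.

HB.instance Definition _ :=
  GRing.isSubringClosed.Build F (regular_outside v) regular_outside_subring.

Record regular_ring := RegularRing {
  regval :> F ; regvalP : regular_outside v regval }.

HB.instance Definition _ := [isSub for regval].
HB.instance Definition _ := [Choice of regular_ring by <:].
HB.instance Definition _ :=
  [SubChoice_isSubComNzRing of regular_ring by <:].

End RegularRing.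

Definition finitely_generated (A : nzRingType) (L : lmodType A) : Prop :=
  exists s : seq L, forall x : L,
    exists a : 'I_(size s) -> A, x = \sum_(i < size s) a i *: s`_i.

Definition projective (A : nzRingType) (L : lmodType A) : Prop :=
  forall (M P : lmodType A) (f : {linear M -> P}) (g : {linear L -> P}),
    (forall y, exists x, f x = y) ->
    exists h : {linear L -> M}, forall x, f (h x) = g x.

(** [j : L -> V] exhibits [V] as the tensor product of [K] and [L] over [A],
    where [K] is an [A]-algebra along [f] (universal property). *)
Definition is_base_change (A : comNzRingType) (K : fieldType)
    (f : {rmorphism A -> K}) (L : lmodType A) (V : lmodType K)
    (j : {linear L -> V | f \; *:%R}) : Prop :=
  forall (W : lmodType K) (g : {linear L -> W | f \; *:%R}),
    exists2 h : {linear V -> W}, (forall x, h (j x) = g x) &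
      forall h' : {linear V -> W}, (forall x, h' (j x) = g x) -> h' =1 h.

Definition has_rank (F : fieldType) (v : dvaluation F)
    (L : lmodType (regular_ring v)) (n : nat) : Prop :=
  exists (W : vectType F)
    (j : {linear L -> W | (\val : {rmorphism regular_ring v -> F}) \; *:%R}),
    is_base_change j /\ \dim {:W} = n.

(** Ultrametric norms, homogeneous with respect to [absA : A -> R]. *)
Definition ultrametric_norm (R : realType) (A : nzRingType) (absA : A -> R)
    (M : lmodType A) (nm : M -> R) : Prop :=
  [/\ forall x, 0 <= nm x,
      forall x, nm x = 0 <-> x = 0,
      forall x y, nm (x + y) <= Num.max (nm x) (nm y) &
      forall a x, nm (a *: x) = absA a * nm x].

Section Lattices.
Variables (R : realType) (F : fieldType) (v : dvaluation F).
Variables (Fv : fieldType) (w : dvaluation Fv) (iota : {rmorphism F -> Fv}).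

Definition is_lattice (L : lmodType (regular_ring v)) (nm : L -> R) : Prop :=
  [/\ finitely_generated L, projective L,
      ultrametric_norm (fun a : regular_ring v => vabs R w (iota (val a))) nm &
      forall rho : R, finite_set [set l | nm l <= rho]].

End Lattices.

(** The morphism [A -> F_oo]. *)
Definition regular_to (F : fieldType) (v : dvaluation F) (Fv : fieldType)
    (iota : {rmorphism F -> Fv}) : {rmorphism regular_ring v -> Fv} :=
  iota \o \val.

Section Volume.
Variables (R : realType) (V : zmodType) (N : V -> R).

Definition norm_open : set (set V) :=
  [set U | forall x, U x ->
     exists2 e : R, 0 < e & forall y, N (y - x) < e -> U y].

Definition borel : measurableType _ := g_sigma_algebraType norm_open.

(** Translation-invariant Borel measure giving mass 1 to the ball of radius
    [r] (such a measure is unique when [V] is locally compact and second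
    countable: it is the normalized Haar measure). *)
Definition normalized_haar (r : R) (mu : {measure set borel -> \bar R}) : Prop :=
  (forall (x : V) (E : set borel), measurable E ->
     mu [set (x + y : V) | y in E] = mu E) /\
  mu [set x | N x <= r] = 1%E.

Definition fundamental_domain (G : set V) (D : set borel) : Prop :=
  measurable D /\ forall x : V, exists! g : V, G g /\ D (x - g).

(** The total mass of the measure induced by [mu] on [V / G], for [G] a
    countable subgroup: the measure of any Borel fundamental domain, all of
    which have the same measure.  The infimum selects this common value. *)
Definition covolume (mu : {measure set borel -> \bar R}) (G : set V) : \bar R :=
  ereal_inf [set mu D | D in fundamental_domain G].

End Volume.

(* Main.v *)
From HB Require Import structures.
Require Import Defs.
From mathcomp Require Import all_boot all_order all_algebra all_field.
From mathcomp Require Import finmap.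
From mathcomp Require Import all_classical all_reals all_analysis.
From mathcomp Require Import zify ring.

Set Implicit Arguments.
Unset Strict Implicit.
Unset Printing Implicit Defensive.

Import Order.TTheory GRing.Theory Num.Theory.
Local Open Scope classical_set_scope.
Local Open Scope ring_scope.

(** For a ball [B_i] of radius [r c^i] one has [mu B_i = c^(n i)]: by successive
    approximation [B_i] is free of rank [n] over the complete valuation ring, so
    [B_(i-1)] has index [c^n] in [B_i].  A Borel fundamental domain [D] of
    [V/Lambda], cut along the cosets of [B_i] and shifted back into [B_i], gives
    [mu B_i <= #(Lambda `&` B_i) * mu D]; this is the inequality.  When
    [V = Lambda + B_i] there is a fundamental domain inside [B_i], whose translates
    by [Lambda `&` B_i] tile [B_i]; this gives equality.

    That [V = Lambda + B_i] for large [i] reduces to [F_oo = A + ball].  Let [x] be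
    in [F].  By weak approximation one may assume [x] regular at the finitely many
    places [u <> oo] above the place of [k(T)] below [oo].  Writing [x] in a basis
    of [F] over [k(T)] without poles at the other places and splitting the
    coefficients into partial fractions, [x] is, up to a bounded error, an element
    [b] that has only bounded poles at these [u] and no pole elsewhere except at
    [oo].  Finally [b] is corrected by one of finitely many elements, because the
    bounded poles at the places [u] have finitely many principal parts. *)


(** * Discrete valuations *)

(** The residue field is never formed: independence modulo a uniformizer is expressed by valuations
    of coefficients, and a maximal independent family generates because a dimension bounds its
    length. This argument serves for the balls of [V], where the length is the rank [n], and for [F]
    over [k(T)], where the degree bounds the number of places above a given one and, with finite
    residue fields, the number of principal parts.

    Finiteness of the residue field of [w] is extracted from the norm on a nonzero vector, and
    descends from there to [F] and [k(T)]; the zero space is therefore treated apart.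

    [V] and the rank are given by universal properties only, so bases must be produced by comparing
    these. Since [covolume] is an infimum, the lower bound must hold for every Borel domain, while
    the upper bound takes a single well-chosen one. *)

Section DValuationArithmetic.
Variables (K : fieldType) (v : dvaluation K).
Implicit Types (m n : int) (x y : K).

Lemma vge0 m : vge v m 0.
Proof. by left. Qed.

Lemma vge_dval x : vge v (v x) x.
Proof. by right. Qed.

Lemma vgeE m x : x != 0 -> vge v m x <-> m <= v x.
Proof. by move=> x0; split; [case=> [/eqP|//]; rewrite (negPf x0)|right]. Qed.

Lemma vge_trans m n x : m <= n -> vge v n x -> vge v m x.
Proof. by move=> mn [->|h]; [left|right; exact: le_trans h]. Qed.

Lemma vgeN m x : vge v m x -> vge v m (- x).
Proof. by move=> h; rewrite -sub0r; apply: vgeB => //; exact: vge0. Qed.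

Lemma vgeD m x y : vge v m x -> vge v m y -> vge v m (x + y).
Proof. by move=> hx hy; rewrite -(opprK y); apply: vgeB => //; exact: vgeN. Qed.

Lemma vge_sum m (I : Type) (s : seq I) (P : pred I) (f : I -> K) :
  (forall i, P i -> vge v m (f i)) -> vge v m (\sum_(i <- s | P i) f i).
Proof. by move=> h; elim/big_ind: _ => //; [exact: vge0|exact: vgeD]. Qed.

Lemma vgeM m n x y : vge v m x -> vge v n y -> vge v (m + n) (x * y).
Proof.
move=> [->|hx]; first by rewrite mul0r => _; exact: vge0.
move=> [->|hy]; first by rewrite mulr0; exact: vge0.
have [->|x0] := eqVneq x 0; first by rewrite mul0r; exact: vge0.
have [->|y0] := eqVneq y 0; first by rewrite mulr0; exact: vge0.
by right; rewrite dvalM// lerD.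
Qed.

Lemma vge0Ml m x y : vge v 0 x -> vge v m y -> vge v m (x * y).
Proof. by move=> hx hy; rewrite -(add0r m); exact: vgeM. Qed.

Lemma vge0Mr m x y : vge v m x -> vge v 0 y -> vge v m (x * y).
Proof. by move=> hx hy; rewrite -(addr0 m); exact: vgeM. Qed.

Lemma vgeX m x k : vge v m x -> vge v (m *+ k) (x ^+ k).
Proof.
move=> h; elim: k => [|k IH]; first by rewrite expr0; exact: vge1.
by rewrite exprS mulrS; exact: vgeM.
Qed.

Lemma vge0X x k : vge v 0 x -> vge v 0 (x ^+ k).
Proof. by move=> /(vgeX k); rewrite mul0rn. Qed.

Lemma dvalV x : v x^-1 = - v x.
Proof.
have [->|x0] := eqVneq x 0; first by rewrite invr0 dval0 oppr0.
apply: (addrI (v x)); rewrite subrr -dvalM ?invr_eq0//.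
by rewrite mulfV// dval1.
Qed.

Lemma dvalX x k : v (x ^+ k) = v x *+ k.
Proof.
have [->|x0] := eqVneq x 0.
  by rewrite dval0 mul0rn expr0n; case: k => [|k]; rewrite ?dval1 ?dval0.
elim: k => [|k IH]; first by rewrite expr0 dval1.
by rewrite exprS mulrS dvalM ?expf_neq0// IH.
Qed.

Lemma dvalXz x m : v (x ^ m) = v x * m.
Proof.
case: m => m; first by rewrite -exprnP dvalX pmulrn mulrzz.
by rewrite NegzE -exprnN dvalV dvalX mulrN pmulrn mulrzz.
Qed.

Lemma vge_succF x : x != 0 -> ~ vge v (v x + 1) x.
Proof. by move=> x0 /(vgeE _ x0); rewrite lezD1 ltxx. Qed.

Lemma not_vge m x : ~ vge v m x -> x != 0 /\ v x < m.
Proof.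
move=> h; split; first by apply/eqP => x0; apply: h; left.
by rewrite ltNge; apply/negP => hm; apply: h; right.
Qed.

Lemma dvalD_dominant x y : x != 0 -> vge v (v x + 1) y ->
  x + y != 0 /\ v (x + y) = v x.
Proof.
move=> x0 hy.
have xy0 : x + y != 0.
  apply/eqP => /eqP; rewrite addr_eq0 => /eqP xy.
  by apply: (vge_succF x0); rewrite {2}xy; exact: vgeN.
split=> //; apply/eqP; rewrite eq_le; apply/andP; split; last first.
  apply/(vgeE _ xy0)/vgeD; first exact: vge_dval.
  by apply: vge_trans hy; rewrite lerDl.
rewrite leNgt; apply/negP => h.
apply: (vge_succF x0).
have := vgeB (m := v x + 1) (v := v) (x := x + y) (y := y).
rewrite addrK; apply => //; apply/(vgeE _ xy0).
by rewrite lezD1.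
Qed.

Lemma sum_dominant_neq0 (g : nat) (f : nat -> K) (k : nat) : (k < g)%N ->
  f k != 0 -> (forall i, (i < g)%N -> i != k -> vge v (v (f k) + 1) (f i)) ->
  \sum_(i < g) f i != 0.
Proof.
move=> kg fk h; rewrite (bigD1 (Ordinal kg))//=.
apply: (proj1 (dvalD_dominant fk _)).
by apply: vge_sum => i; rewrite -val_eqE/= => ik; exact: h.
Qed.

Lemma dval_unitV x : x != 0 -> v x = 0 -> vge v 0 x^-1.
Proof. by move=> x0 vx; right; rewrite dvalV vx oppr0. Qed.

End DValuationArithmetic.

(** * Modules over a valuation ring modulo a uniformizer *)

Section ResidualBasis.
Variables (K : fieldType) (q : dvaluation K) (z : K) (qz : q z = 1).
Variables (V : lmodType K).
Implicit Types (M : set V) (f : nat -> V) (a : nat -> K).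

Lemma uniformizer_neq0 : z != 0.
Proof. by apply/eqP => z0; move: qz; rewrite z0 dval0. Qed.

Lemma vge_divz m x : vge q (m + 1) x -> vge q m (x / z).
Proof.
move=> h; have := vgeM h (vge_dval q z^-1).
by rewrite dvalV qz -addrA subrr addr0.
Qed.

(** A dimension bound that makes sense for a bare [lmodType]. *)
Definition dependent_above (d : nat) : Prop := forall g f, (d < g)%N ->
  exists a, (exists2 i, (i < g)%N & a i != 0) /\ \sum_(i < g) a i *: f i = 0.

Definition valuation_submodule M : Prop :=
  [/\ M 0, forall x y, M x -> M y -> M (x + y) &
      forall (c : K) x, vge q 0 c -> M x -> M (c *: x)].

Lemma submodule_sum M (I : Type) (s : seq I) (P : pred I) (f : I -> V) :
  valuation_submodule M -> (forall i, P i -> M (f i)) ->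
  M (\sum_(i <- s | P i) f i).
Proof. by move=> [M0 MD _] h; elim/big_ind: _. Qed.

Lemma submodule_opp M x : valuation_submodule M -> M x -> M (- x).
Proof.
move=> [_ _ MZ] Mx; rewrite -scaleN1r; apply: MZ => //.
by apply: vgeN; exact: vge1.
Qed.

(** The [f i], [i < g], lie in [M] and their classes in [M / z M] are linearly
    independent over the residue field. *)
Definition residually_free M g f : Prop :=
  (forall i, (i < g)%N -> M (f i)) /\
  forall a, (forall i, (i < g)%N -> vge q 0 (a i)) ->
    (exists2 y, M y & \sum_(i < g) a i *: f i = z *: y) ->
    forall i, (i < g)%N -> vge q 1 (a i).

(** Dividing a nontrivial relation by its coefficient of least valuation gives an integral relation
    with a coefficient 1, against freeness modulo [z]. *)
Lemma residually_free_free M g f a : M 0 -> residually_free M g f ->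
  \sum_(i < g) a i *: f i = 0 -> forall i, (i < g)%N -> a i = 0.
Proof.
move=> M0 [_ fr] sum0; apply: contrapT => /existsNP[i0] /not_implyP[i0g /eqP ai0].
have [] := @arg_minP _ int 'I_g (Ordinal i0g) (fun i => a i != 0)
  (fun i => q (a i)) ai0.
move=> i1 ai1 imin.
have h : forall i, (i < g)%N -> vge q 0 (a i / a i1).
  move=> i ig; have [->|ai] := eqVneq (a i) 0; first by rewrite mul0r; left.
  right; rewrite dvalM ?invr_eq0// dvalV subr_ge0.
  exact: (imin (Ordinal ig)).
have : vge q 1 (a i1 / a i1).
  apply: (fr _ h _ _ (ltn_ord i1)); exists 0 => //; rewrite scaler0.
  transitivity (\sum_(i < g) (a i1)^-1 *: (a i *: f i)).
    by apply: eq_bigr => i _; rewrite scalerA mulrC.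
  by rewrite -scaler_sumr sum0 scaler0.
rewrite divff// => /(vgeE _ _ (oner_neq0 K)).
by rewrite dval1.
Qed.

Lemma residually_free_leq M g f d : M 0 -> dependent_above d ->
  residually_free M g f -> (g <= d)%N.
Proof.
move=> M0 dep fr; rewrite leqNgt; apply/negP => dg.
have [a [[i ig /eqP ai] sum0]] := dep g f dg.
exact/ai/(residually_free_free M0 fr sum0).
Qed.

(** A residually free family of maximal length generates modulo [z]: adjoining [x] destroys
    freeness, and the coefficient of [x] in the offending relation is a unit. *)
Lemma residual_basis M d : dependent_above d -> valuation_submodule M ->
  exists g f, residually_free M g f /\
    forall x, M x -> exists a y, [/\ forall i, (i < g)%N -> vge q 0 (a i), M y &
      x = \sum_(i < g) a i *: f i + z *: y].
Proof.
move=> dep subM; have [M0 MD MZ] := subM.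
pose P g := `[< exists f, residually_free M g f >].
have exP : exists g, P g.
  exists 0%N; apply/asboolP; exists (fun=> 0); split => //.
have leP g : P g -> (g <= d)%N.
  by move=> /asboolP[f fr]; exact: (residually_free_leq M0 dep fr).
case: (ex_maxnP exP leP) => g /asboolP[f fr] gmax.
exists g, f; split=> // x Mx.
pose f' i := if (i < g)%N then f i else x.
have f'sum a : \sum_(i < g.+1) a i *: f' i = \sum_(i < g) a i *: f i + a g *: x.
  rewrite big_ord_recr/= /f' ltnn; congr (_ + _).
  by apply: eq_bigr => i _; rewrite ltn_ord.
have : ~ residually_free M g.+1 f'.
  move=> fr'; have /gmax : P g.+1 by apply/asboolP; exists f'.
  by rewrite ltnn.
move=> /not_andP[|].
  move=> /existsNP[i /not_implyP[_]]; rewrite /f'; case: ifP => // ig.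
  by have := (proj1 fr) i ig.
move=> /existsNP[a /not_implyP[a0 /not_implyP[[y My]]]].
rewrite f'sum => eqy nvge.
(* Otherwise the term in [x] could be moved into [z *: y], leaving a relation among the [f i]
   alone. *)
have ag : ~ vge q 1 (a g).
  move=> hag; apply: nvge => i; rewrite ltnS leq_eqVlt => /predU1P[->//|ig].
  apply: (proj2 fr) ig => [k kg|]; first by apply: a0; rewrite ltnW.
  exists (y - (a g / z) *: x).
    apply: MD => //; apply: submodule_opp => //; apply: MZ => //.
    exact: vge_divz.
  rewrite scalerBr scalerA mulrC divfK ?uniformizer_neq0// -eqy.
  by rewrite addrK.
have [ag0 qag] := not_vge ag.
have qag0 : q (a g) = 0.
  have /(vgeE _ _ ag0) := a0 g (ltnSn g); lia.
have hV := dval_unitV ag0 qag0.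
exists (fun i => - (a i / a g)), ((a g)^-1 *: y); split.
- by move=> i ig; apply: vgeN; apply: vge0Ml => //; apply: a0; rewrite ltnW.
- exact: MZ.
- rewrite scalerA mulrC -scalerA -eqy scalerDr scalerA mulVf// scale1r addrA.
  rewrite scaler_sumr -big_split/= big1 ?add0r// => i _.
  by rewrite scalerA scaleNr mulrC addNr.
Qed.

Lemma finite_combinations (S : seq K) g f :
  exists E : seq V, forall a, (forall i, (i < g)%N -> a i \in S) ->
    \sum_(i < g) a i *: f i \in E.
Proof.
elim: g => [|g [E hE]].
  by exists [:: 0] => a _; rewrite big_ord0 mem_seq1.
exists [seq e + s *: f g | e <- E, s <- S] => a ha.
rewrite big_ord_recr/=; apply/allpairsP; exists (\sum_(i < g) a i *: f i, a g).
split => //=; last exact: ha.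
by apply: hE => i ig; apply: ha; rewrite ltnW.
Qed.

Lemma residue_cover (S : seq K) M d : dependent_above d ->
  valuation_submodule M ->
  (forall x, vge q 0 x -> exists2 s, s \in S & vge q 1 (x - s)) ->
  exists E : seq V, forall x, M x ->
    exists2 e, e \in E & exists2 y, M y & x - e = z *: y.
Proof.
move=> dep subM hS; have [M0 MD MZ] := subM.
have [g [f [fr hf]]] := residual_basis dep subM.
have [E hE] := finite_combinations S g f; exists E => x Mx.
have [a [y [a0 My xE]]] := hf x Mx.
have /choice[s hs] : forall i, exists s, (i < g)%N -> s \in S /\ vge q 1 (a i - s).
  move=> i; case: (ltnP i g) => ig; last by exists 0.
  by have [s] := hS _ (a0 i ig); exists s.
exists (\sum_(i < g) s i *: f i); first by apply: hE => i /hs[].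
exists (y + \sum_(i < g) ((a i - s i) / z) *: f i).
  apply: MD => //; apply: submodule_sum => // i _; apply: MZ.
    by apply: vge_divz; have [] := hs _ (ltn_ord i).
  exact: (proj1 fr).
rewrite xE scalerDr addrC addrA [RHS]addrC; congr (_ + _).
rewrite addrC -sumrB scaler_sumr; apply: eq_bigr => i _.
by rewrite scalerA mulrC divfK ?uniformizer_neq0// scalerBl.
Qed.

Lemma residue_cover_iter (S : seq K) M d k : dependent_above d ->
  valuation_submodule M ->
  (forall x, vge q 0 x -> exists2 s, s \in S & vge q 1 (x - s)) ->
  exists E : seq V, forall x, M x ->
    exists2 e, e \in E & exists2 y, M y & x - e = z ^+ k *: y.
Proof.
move=> dep subM hS; have [E hE] := residue_cover dep subM hS.
elim: k => [|k [E' hE']].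
  exists [:: 0] => x Mx; exists 0; first by rewrite mem_seq1.
  by exists x => //; rewrite expr0 scale1r subr0.
exists [seq e' + z ^+ k *: e | e' <- E', e <- E] => x /hE'[e' e'E [y My ye]].
have [e eE [y' My' ye']] := hE y My.
exists (e' + z ^+ k *: e); first by apply/allpairsP; exists (e', e).
exists y' => //; rewrite exprSr -scalerA -ye' scalerBr -ye.
by rewrite opprD addrA.
Qed.

End ResidualBasis.

(** * Weak approximation *)

Section Separation.
Variable (F : fieldType).
Implicit Types (u v : dvaluation F).

(** Applied to an element and its inverse, the hypothesis sends units of [u] to units of [v], so [v]
    is [v p] times [u] for a uniformizer [p] of [u]. As [v] takes the value 1, [v p = 1]. *)
Lemma dval_le_eq u v : (forall x, vge u 0 x -> vge v 0 x) -> (u : F -> int) = v.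
Proof.
move=> h; have [p up] := dval_uniformizer u.
have p0 : p != 0 by apply/eqP => p0; move: up; rewrite p0 dval0.
have vx x : x != 0 -> v x = v p * u x.
  move=> x0; pose y := x / p ^ (u x).
  have y0 : y != 0 by rewrite mulf_neq0// invr_eq0 expfz_neq0.
  have uy : u y = 0.
    by rewrite dvalM ?invr_eq0 ?expfz_neq0// dvalV dvalXz up mul1r subrr.
  have vy : 0 <= v y by apply/(vgeE _ _ y0)/h; right; rewrite uy.
  have vy' : v y <= 0.
    have yV : y^-1 != 0 by rewrite invr_eq0.
    rewrite -oppr_ge0 -dvalV; apply/(vgeE _ _ yV)/h/(vgeE _ _ yV).
    by rewrite dvalV uy.
  have : v y = 0 by apply/eqP; rewrite eq_le vy vy'.
  rewrite dvalM ?invr_eq0 ?expfz_neq0// dvalV dvalXz => /eqP.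
  by rewrite subr_eq0 => /eqP.
have [t vt] := dval_uniformizer v.
have t0 : t != 0 by apply/eqP => t0; move: vt; rewrite t0 dval0.
have vp0 : 0 <= v p by apply/(vgeE _ _ p0)/h; right; rewrite up.
have vp1 : v p = 1.
  move: vt; rewrite vx// => vt; move: vp0 vt.
  case: (v p) => // k _ hk; have : (k%:Z %| 1)%Z by apply/dvdzP; exists (u t); lia.
  by rewrite dvdz1 absz_nat => /eqP ->.
apply/funext => x; have [->|x0] := eqVneq x 0; first by rewrite !dval0.
by rewrite vx// vp1 mul1r.
Qed.

(** Neither valuation ring contains the other; the quotient of two elements witnessing this is as
    required. *)
Lemma separate2 u v : (u : F -> int) <> v -> exists f, u f < 0 /\ 0 < v f.
Proof.
move=> uv.
have sep u' v' : (u' : F -> int) <> v' -> exists x, vge u' 0 x /\ x != 0 /\ v' x < 0.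
  move=> uv'; apply: contrapT => /forallNP h; apply/uv'/dval_le_eq => x ux.
  by apply: contrapT => /not_vge vx; apply: (h x).
have [x [ux [x0 vx]]] := sep u v uv.
have [y [vy [y0 uy]]] := sep v u (fun e => uv (esym e)).
move: ux vy => /(vgeE _ _ x0) ux /(vgeE _ _ y0) vy.
exists (y / x); rewrite !dvalM ?invr_eq0// !dvalV; lia.
Qed.

(* [f ^+ k / (1 + f ^+ k)] is close to 1 at the poles of [f] and to 0 at its
   zeros. *)
Lemma dval_switch u (f : F) (k : nat) : (0 < k)%N -> u f < 0 ->
  [/\ 1 + f ^+ k != 0, f ^+ k / (1 + f ^+ k) != 0,
      u (f ^+ k / (1 + f ^+ k)) = 0 &
      vge u k%:Z (1 - f ^+ k / (1 + f ^+ k))].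
Proof.
move=> k0 uf.
have f0 : f != 0 by apply/eqP => f0; move: uf; rewrite f0 dval0.
have fk0 : f ^+ k != 0 by rewrite expf_neq0.
have ufk : u (f ^+ k) <= - k%:Z.
  by rewrite dvalX pmulrn mulrzz; nia.
have [|ne e] := @dvalD_dominant _ u (f ^+ k) 1 fk0.
  by right; rewrite dval1; lia.
rewrite addrC; split=> //; first by rewrite mulf_neq0// invr_eq0.
  by rewrite dvalM ?invr_eq0// dvalV e subrr.
have -> : 1 - f ^+ k / (f ^+ k + 1) = (f ^+ k + 1)^-1 by field.
by right; rewrite dvalV e; lia.
Qed.

Lemma dval_switch_zero u (f : F) (k : nat) : (0 < k)%N -> 0 < u f ->
  [/\ 1 + f ^+ k != 0, f ^+ k / (1 + f ^+ k) != 0 &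
      u (f ^+ k / (1 + f ^+ k)) = u f *+ k].
Proof.
move=> k0 uf.
have f0 : f != 0 by apply/eqP => f0; move: uf; rewrite f0 dval0.
have fk0 : f ^+ k != 0 by rewrite expf_neq0.
have ufk : 0 < u (f ^+ k) by rewrite dvalX pmulrn mulrzz; nia.
have [|ne e] := @dvalD_dominant _ u 1 (f ^+ k) (oner_neq0 F).
  by right; rewrite dval1; lia.
split=> //; first by rewrite mulf_neq0// invr_eq0.
by rewrite dvalM ?invr_eq0// dvalV e dval1 subr0 dvalX.
Qed.

(** Induction on the number of places: [f] handles the earlier ones, [h] the new one, and they are
    combined according to the sign of [us g f]. The exponent [k] exceeds the pole orders of [h] at
    the earlier places. *)
Lemma separate v (us : nat -> dvaluation F) g :
  (forall i, (i < g)%N -> (v : F -> int) <> us i) ->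
  exists f, v f < 0 /\ forall i, (i < g)%N -> 0 < us i f.
Proof.
elim: g => [|g IH] ne.
  have [p vp] := dval_uniformizer v.
  by exists p^-1; split=> //; rewrite dvalV vp.
have [f [vf uf]] : exists f, v f < 0 /\ forall i, (i < g)%N -> 0 < us i f.
  by apply: IH => i ig; apply: ne; rewrite ltnW.
have [h [vh ugh]] := separate2 (ne g (ltnSn g)).
have f0 : f != 0 by apply/eqP => f0; move: vf; rewrite f0 dval0.
have h0 : h != 0 by apply/eqP => h0; move: vh; rewrite h0 dval0.
have [k k0 hk] : exists2 k, (0 < k)%N & forall i, (i < g)%N -> - us i h < k%:Z.
  exists (\max_(i < g) `|us i h|%N).+1 => // i ig.
  have := leq_bigmax (F := fun i : 'I_g => `|us i h|%N) (Ordinal ig) => /=; lia.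
case: (ltrgt0P (us g f)) => ugf.
- exists f; split=> // i; rewrite ltnS leq_eqVlt => /predU1P[->//|]; exact: uf.
(* The switch of [f] is a unit at [v] and at [us g], where [h] is already right, and has a zero of
   order at least [k] at the earlier places. *)
- have [n0 e0 ue _] := dval_switch k0 ugf.
  have [_ _ ve _] := dval_switch k0 vf.
  exists (f ^+ k / (1 + f ^+ k) * h); rewrite dvalM// ve add0r; split=> // i.
  rewrite ltnS leq_eqVlt => /predU1P[->|ig]; first by rewrite dvalM// ue add0r.
  have [_ _ uie] := dval_switch_zero k0 (uf i ig).
  rewrite dvalM// uie pmulrn mulrzz; move: (hk i ig) (uf i ig); nia.
- exists (f ^+ k * h); split.
    by rewrite dvalM ?expf_neq0// dvalX pmulrn mulrzz; nia.
  move=> i; rewrite ltnS leq_eqVlt => /predU1P[->|ig].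
    by rewrite dvalM ?expf_neq0// dvalX ugf mul0rn add0r.
  by rewrite dvalM ?expf_neq0// dvalX pmulrn mulrzz; move: (hk i ig) (uf i ig); nia.
Qed.

Lemma approximation v (us : nat -> dvaluation F) g (k : nat) :
  (forall i, (i < g)%N -> (v : F -> int) <> us i) ->
  exists e, vge v k%:Z (1 - e) /\ forall i, (i < g)%N -> vge (us i) k%:Z e.
Proof.
move=> /separate[f [vf uf]].
have [_ _ _ he] := dval_switch (ltn0Sn k) vf.
exists (f ^+ k.+1 / (1 + f ^+ k.+1)); split.
  by apply: vge_trans he; rewrite lez_nat.
move=> i ig; have [_ _ h] := dval_switch_zero (ltn0Sn k) (uf i ig).
by right; rewrite h pmulrn mulrzz; move: (uf i ig); nia.
Qed.

End Separation.

(** * Places of a rational function field *)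

Section LinearDependence.
Import VectorInternalTheory.
Variable K : fieldType.

Lemma dependent_above_rV n : @dependent_above K 'rV[K]_n n.
Proof.
move=> g f ng; pose A := \matrix_(i < g) f i.
have : kermx A != 0.
  rewrite kermx_eq0 /row_free; apply/eqP => rA.
  by have := rank_leq_col A; rewrite rA leqNgt ng.
case/rowV0Pn => x /sub_kermxP xA x0.
exists (fun i => oapp (x 0) 0 (insub i)); split.
  move/rV0Pn: x0 => [i xi]; exists i => //.
  by rewrite insubT//= => ig; rewrite (_ : Sub _ _ = i)//; exact: val_inj.
rewrite -[RHS]xA mulmx_sum_row; apply: eq_bigr => i _.
rewrite rowK insubT//= => ig; congr (x _ _ *: _); exact: val_inj.
Qed.

Lemma dependent_above_inj (V W : lmodType K) (h : {linear V -> W}) d :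
  injective h -> dependent_above W d -> dependent_above V d.
Proof.
move=> hinj dep g f dg; have [a [ai sum0]] := dep g (h \o f) dg.
exists a; split=> //; apply: hinj; rewrite linear0 linear_sum -[RHS]sum0.
by apply: eq_bigr => i _; rewrite linearZ.
Qed.

Lemma dependent_above_vect (V : vectType K) : dependent_above V (\dim {:V}).
Proof.
rewrite dimvf; pose h : {linear V -> 'rV[K]_(dim V)} := v2r.
apply: (dependent_above_inj (h := h)); last exact: dependent_above_rV.
exact: v2r_inj.
Qed.

End LinearDependence.

Lemma fraction_repr (D : idomainType) (x : {fraction D}) :
  exists f g, g != 0 /\ x = FracField.tofrac f / FracField.tofrac g.
Proof.
elim/quotW: x => r; have g0 := denom_ratioP r.
exists (frac r).1, (frac r).2; split=> //.
have g0' : FracField.tofrac (frac r).2 != 0 by rewrite tofrac_eq0.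
apply: (mulIf g0'); rewrite divfK//.
apply/eqP; rewrite piE FracField.equivfE /FracField.mulf !numden_Ratio ?oner_eq0//.
  by rewrite !mulr1 mulrC.
by rewrite mulr1.
by rewrite mulr1.
Qed.

Lemma partial_fraction_identity (K : fieldType) (f q g p a b : K) :
  g != 0 -> p != 0 -> a * p + b * g = 1 ->
  f / (g * p) = (b * f - q * p) / p + (a * f / g + q).
Proof.
move=> g0 p0 ab; rewrite -[LHS]mul1r -ab.
by field; rewrite g0 p0.
Qed.

Section BaseField.
Variables (K : fieldType) (F : fieldExtType K).

Definition ratf : K -> F := in_alg F.
HB.instance Definition _ := GRing.RMorphism.on ratf.

Lemma ratf_eq0 x : (ratf x == 0) = (x == 0).
Proof. exact: fmorph_eq0. Qed.

Lemma ratfZ (a : K) (x : F) : a *: x = ratf a * x.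
Proof. by rewrite mulr_algl. Qed.

(** Equivalently, [u] and [v] lie above the same place of [K]. *)
Definition over (v u : dvaluation F) : Prop :=
  forall x, vge v 0 (ratf x) -> vge u 0 (ratf x).

End BaseField.

Section PlacesOfRationalFunctions.
Variables (k : finFieldType) (F : fieldExtType {fraction {poly k}}).
Local Notation K := {fraction {poly k}}.
Implicit Types (u v : dvaluation F) (x : K) (p f g : {poly k}).

Local Notation ratf := (@ratf K F).

Definition polyf : {poly k} -> F := ratf \o @FracField.tofrac {poly k}.
HB.instance Definition _ := GRing.RMorphism.on polyf.

Lemma polyf_eq0 p : (polyf p == 0) = (p == 0).
Proof. by rewrite /polyf/= fmorph_eq0 tofrac_eq0. Qed.

Lemma ratf_repr x : exists f g, g != 0 /\ ratf x = polyf f / polyf g.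
Proof.
have [f [g [g0 ->]]] := fraction_repr x.
by exists f, g; split=> //; rewrite fmorph_div.
Qed.

Lemma ratf_tofrac f g : ratf (FracField.tofrac f / FracField.tofrac g) =
  polyf f / polyf g.
Proof. by rewrite fmorph_div. Qed.

Lemma dval_fracf u f g : f != 0 -> g != 0 ->
  u (polyf f / polyf g) = u (polyf f) - u (polyf g).
Proof.
move=> f0 g0; rewrite (dvalM u _ _) ?invr_eq0 ?polyf_eq0//.
by rewrite (dvalV u (polyf g)).
Qed.

Lemma fracf_neq0 f g : f != 0 -> g != 0 -> polyf f / polyf g != 0.
Proof. by move=> f0 g0; apply: mulf_neq0; rewrite ?invr_eq0 polyf_eq0. Qed.

(** Since [c ^+ #|k| = c], the valuation is fixed by multiplication by [#|k| > 1]; at [c = 0] the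
    default value 0 fits too. *)
Lemma dval_polyfC u (c : k) : u (polyf c%:P) = 0.
Proof.
have : u (polyf c%:P) *+ #|k| = u (polyf c%:P).
  by rewrite -dvalX -rmorphXn -polyC_exp expf_card.
case: #|k| (finNzRing_gt1 k) => // m m0 /eqP.
by rewrite mulrS addrC -subr_eq0 addrK mulrn_eq0; case: m m0 => //= m _ /eqP.
Qed.

Lemma vge_polyfC u (c : k) : vge u 0 (polyf c%:P).
Proof. by right; rewrite dval_polyfC. Qed.

Lemma polyf_MXaddC p c : polyf (p * 'X + c%:P) = polyf p * polyf 'X + polyf c%:P.
Proof. by rewrite rmorphD rmorphM. Qed.

Lemma vge_polyf u p : vge u 0 (polyf 'X) -> vge u 0 (polyf p).
Proof.
move=> uX; elim/poly_ind: p => [|p c IH]; first by rewrite rmorph0; exact: vge0.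
by rewrite polyf_MXaddC; apply: vgeD; [exact: vge0M|exact: vge_polyfC].
Qed.

(** At a pole of ['X] the leading term dominates. *)
Lemma dval_polyf_pole u p : u (polyf 'X) < 0 -> p != 0 ->
  u (polyf p) = u (polyf 'X) * (size p).-1%:Z.
Proof.
move=> uX; elim/poly_ind: p => [|p c IH]; first by rewrite eqxx.
have X0 : polyf 'X != 0 by rewrite polyf_eq0 polyX_eq0.
have [->|p0] := eqVneq p 0.
  rewrite mul0r add0r polyC_eq0 => c0; rewrite dval_polyfC.
  by rewrite size_polyC c0 mulr0.
move=> _; rewrite size_MXaddC (negPf p0)/= polyf_MXaddC.
have pX0 : polyf p * polyf 'X != 0 by apply: mulf_neq0 => //; rewrite polyf_eq0.
have sp : (0 < size p)%N by rewrite size_poly_gt0.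
have upX : u (polyf p * polyf 'X) = u (polyf 'X) * (size p)%:Z.
  rewrite dvalM ?polyf_eq0 ?polyX_eq0// IH//.
  by rewrite -[in RHS](prednK sp) intS mulrDr mulr1 addrC.
have [|_ ->//] := @dvalD_dominant _ u _ (polyf c%:P) pX0.
by apply: vge_trans (vge_polyfC u c); rewrite upX; nia.
Qed.

(** If [u] were trivial on [k(T)], the powers of a uniformizer would be independent over [k(T)], as
    the terms of a relation would have distinct valuations; but [F] has finite degree. *)
Lemma dval_nontrivial u : exists p, p != 0 /\ u (polyf p) != 0.
Proof.
apply: contrapT => /forallNP triv.
have triv0 p : p != 0 -> u (polyf p) = 0.
  by move=> p0; apply/eqP/negPn/negP => up; apply: (triv p).
have trivK x : x != 0 -> u (ratf x) = 0.
  move=> x0; have [f [g [g0 e]]] := ratf_repr x.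
  have f0 : f != 0.
    by apply: contraNneq x0 => f0; rewrite -(ratf_eq0 F) e f0 rmorph0 mul0r.
  by rewrite e dval_fracf// !triv0.
have [t ut] := dval_uniformizer u.
have t0 : t != 0 by apply/eqP => t0; move: ut; rewrite t0 dval0.
have [d dep] : exists d, @dependent_above K F d.
  by eexists; exact: dependent_above_vect.
have [a [[i0 i0g ai0] sum0]] := dep d.+1 (fun i => t ^+ i) (ltnSn _).
move: i0g sum0; set g := d.+1 => i0g sum0.
have exi : exists i, (i < g)%N && (a i != 0) by exists i0; apply/andP; split.
case: (ex_minnP exi) => i1 /andP[i1g ai1] imin.
have at0 i : a i != 0 -> a i *: t ^+ i != 0 /\ u (a i *: t ^+ i) = i%:Z.
  move=> ai; rewrite ratfZ.
  have aiF : ratf (a i) != 0 by rewrite ratf_eq0.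
  rewrite mulf_neq0 ?expf_neq0//; split=> //.
  by rewrite dvalM ?expf_neq0// trivK// dvalX ut add0r natz.
apply: (elimN eqP _ sum0).
apply: (@sum_dominant_neq0 _ u g (fun i => a i *: t ^+ i) i1) => //.
  by have [] := at0 _ ai1.
move=> i ig ii1; have [->|ai] := eqVneq (a i) 0.
  by rewrite scale0r; exact: vge0.
right; have [_ ->] := at0 _ ai1; have [_ ->] := at0 _ ai.
have : (i1 <= i)%N by apply: imin; rewrite ig ai.
by rewrite leq_eqVlt eq_sym (negPf ii1)/=; lia.
Qed.

Lemma dval_nontrivial_ratf u : exists x : K, x != 0 /\ 0 < u (ratf x).
Proof.
have [p [p0 up]] := dval_nontrivial u.
pose x : K := FracField.tofrac p.
have x0 : x != 0 by rewrite tofrac_eq0.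
case: (ltrgt0P (u (ratf x))) => ux.
- by exists x.
- by exists x^-1; rewrite invr_eq0 fmorphV dvalV oppr_gt0.
- by move: up; rewrite ux eqxx.
Qed.

(** * Places above the pole of ['X] *)

Section PoleOfX.
Variables (v : dvaluation F) (vX : v (polyf 'X) < 0).

Lemma over_pole u : u (polyf 'X) < 0 -> over v u.
Proof.
move=> uX x; have [f [g [g0 ->]]] := ratf_repr x.
have [->|f0] := eqVneq f 0; first by rewrite rmorph0 mul0r => _; exact: vge0.
have fg0 : polyf f / polyf g != 0 by exact: fracf_neq0.
move=> /(vgeE _ _ fg0) h; apply/(vgeE _ _ fg0); move: h.
rewrite (dval_fracf u f0 g0) (dval_fracf v f0 g0).
rewrite (dval_polyf_pole uX f0) (dval_polyf_pole uX g0).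
rewrite (dval_polyf_pole vX f0) (dval_polyf_pole vX g0).
by rewrite -!mulrBr !nmulr_rge0.
Qed.

Lemma not_over_pole u p : ~ over v u -> vge u 0 (polyf p).
Proof.
move=> nov; apply: vge_polyf; right; rewrite leNgt; apply/negP.
by move=> /over_pole.
Qed.

(** Euclidean division: the quotient is a polynomial, and the remainder over [g] has negative
    degree. *)
Lemma split_pole x : exists a b, [/\ x = a + b,
  forall u, ~ over v u -> vge u 0 (ratf a) & vge v 0 (ratf b)].
Proof.
have [f [g [g0 ->]]] := fraction_repr x.
exists (FracField.tofrac (f %/ g)), (FracField.tofrac (f %% g) / FracField.tofrac g).
split; last first.
- rewrite ratf_tofrac; have [->|r0] := eqVneq (f %% g) 0.
    by rewrite rmorph0 mul0r; exact: vge0.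
  right; rewrite (dval_fracf v r0 g0) (dval_polyf_pole vX r0).
  rewrite (dval_polyf_pole vX g0).
  rewrite -mulrBr nmulr_rge0// subr_le0 lez_nat.
  by rewrite -!subn1 leq_sub2r// ltnW// ltn_modpN0.
- by move=> u nov; exact: not_over_pole.
- have g0' : FracField.tofrac g != 0 by rewrite tofrac_eq0.
  apply: (mulIf g0'); rewrite mulrDl !divfK//.
  by rewrite -rmorphM -rmorphD -divp_eq.
Qed.

Lemma denom_pole x : exists2 D : K, D != 0 &
  forall u, ~ over v u -> vge u 0 (ratf D) /\ vge u 0 (ratf (D * x)).
Proof.
have [f [g [g0 ->]]] := fraction_repr x.
have g0' : FracField.tofrac g != 0 by rewrite tofrac_eq0.
exists (FracField.tofrac g) => // u nov; rewrite mulrC divfK//.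
by split; exact: not_over_pole.
Qed.

End PoleOfX.

(** * Places above an irreducible polynomial *)

Section ZeroOfPrime.
Variables (v : dvaluation F) (vX : vge v 0 (polyf 'X)).
Variables (P : {poly k}) (P0 : P != 0) (vP : 0 < v (polyf P)).
(** Minimality stands for irreducibility: [P] generates the prime ideal of the polynomials vanishing
    at [v]. *)
Hypothesis Pmin : forall p, p != 0 -> 0 < v (polyf p) -> (size P <= size p)%N.

Lemma dval_polyf_ge0 u p : vge u 0 (polyf 'X) -> 0 <= u (polyf p).
Proof. by move=> /vge_polyf-/(_ p)[->|//]; rewrite dval0. Qed.

Lemma dval_polyfM u f g : f != 0 -> g != 0 ->
  u (polyf (f * g)) = u (polyf f) + u (polyf g).
Proof. by move=> f0 g0; rewrite (rmorphM polyf f g) dvalM ?polyf_eq0. Qed.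

Lemma dval_polyfX u f n : u (polyf (f ^+ n)) = u (polyf f) *+ n.
Proof. by rewrite (rmorphXn polyf n f) dvalX. Qed.

Lemma size_prime : (1 < size P)%N.
Proof.
rewrite ltnNge; apply/negP => /size1_polyC PC; move: vP.
by rewrite PC dval_polyfC ltxx.
Qed.

(** If the gcd [d] vanishes at [v], minimality makes it associate to [P], which then divides [p].
    Otherwise [P %/ d] vanishes at [v], and minimality makes [d] constant. *)
Lemma coprime_prime p : ~~ (P %| p) -> coprimep P p.
Proof.
move=> nPp; set d := gcdp P p.
have dP : d %| P by exact: dvdp_gcdl.
have Pe : P = (P %/ d) * d by rewrite divpK.
have e0 : P %/ d != 0 by apply: contraNneq P0 => e0; rewrite Pe e0 mul0r.
have d0 : d != 0 by apply: contraNneq P0 => d0; rewrite Pe d0 mulr0.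
have vd := dval_polyf_ge0 d vX.
have : v (polyf P) = v (polyf (P %/ d)) + v (polyf d).
  by rewrite -(dval_polyfM _ e0 d0) -Pe.
case: (ltrP 0 (v (polyf d))) => vd'.
  have /eqP sd : size d == size P by rewrite eqn_leq dvdp_leq//= Pmin.
  have /andP[_ Pd] : d %= P by rewrite -dvdp_size_eqp// sd.
  by case/negP: nPp; apply: (dvdp_trans Pd); exact: dvdp_gcdr.
have -> : v (polyf d) = 0 by apply/eqP; rewrite eq_le vd vd'.
rewrite addr0 => ve; have := Pmin e0; rewrite -ve => /(_ vP).
rewrite {1}Pe size_mul// /coprimep -/d.
have : (0 < size d)%N by rewrite size_poly_gt0.
have : (0 < size (P %/ d)%R)%N by rewrite size_poly_gt0.
by move: (size d) (size (P %/ d)%R) => m l; lia.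
Qed.

Lemma bezout_prime p n : ~~ (P %| p) -> exists a b, a * P ^+ n + b * p = 1.
Proof.
move=> /coprime_prime cp.
have /Bezout_eq1_coprimepP[[a b] ab] : coprimep (P ^+ n) p.
  exact: coprimep_expl.
by exists a, b.
Qed.

(** By Bezout [P] and [p] cannot both vanish at [u]. The place is arbitrary so that [over_prime] can
    compare [u] with [v]. *)
Lemma dval_coprime u p : vge u 0 (polyf 'X) -> 0 < u (polyf P) -> ~~ (P %| p) ->
  u (polyf p) = 0.
Proof.
move=> uX uP nPp; have [a [b]] := bezout_prime 1 nPp.
rewrite expr1 => ab; apply/eqP; rewrite eq_le dval_polyf_ge0// andbT leNgt.
apply/negP => up.
have : vge u 1 (polyf (a * P + b * p)).
  rewrite (rmorphD polyf) !(rmorphM polyf); apply: vgeD.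
    by apply: vge0Ml; [exact: vge_polyf|right].
  by apply: vge0Ml; [exact: vge_polyf|right].
by rewrite ab rmorph1 => /(vgeE _ _ (oner_neq0 F)); rewrite dval1.
Qed.

Lemma prime_factor p : p != 0 -> exists n f, ~~ (P %| f) /\ p = f * P ^+ n.
Proof.
have [m] := ubnP (size p); elim: m p => // m IH p /ltnSE sp p0.
have [Pp|] := boolP (P %| p); last by move=> nPp; exists 0%N, p; rewrite mulr1.
have Pe : p = (p %/ P) * P by rewrite divpK.
have [||n [f [nf fE]]] := IH (p %/ P).
- rewrite size_divp//; apply: leq_trans sp.
  have : (0 < size p)%N by rewrite size_poly_gt0.
  by have := size_prime; move: (size P) (size p) => l l'; lia.
- by apply: contraNneq p0 => e0; rewrite Pe e0 mul0r.
- by exists n.+1, f; split=> //; rewrite exprSr mulrA -fE.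
Qed.

(** On [k(T)] both valuations are positive multiples of the order at [P]. *)
Lemma over_prime u : 0 < u (polyf P) -> over v u.
Proof.
move=> uP x; have uX : vge u 0 (polyf 'X).
  right; rewrite leNgt; apply/negP => uX; move: uP.
  by rewrite (dval_polyf_pole uX P0) ltNge nmulr_rle0.
have [f [g [g0 ->]]] := ratf_repr x.
have [->|f0] := eqVneq f 0; first by rewrite rmorph0 mul0r => _; exact: vge0.
have fg0 : polyf f / polyf g != 0 by exact: fracf_neq0.
move=> /(vgeE _ _ fg0) h; apply/(vgeE _ _ fg0); move: h.
rewrite (dval_fracf u f0 g0) (dval_fracf v f0 g0).
have [a [f' [nf' fE]]] := prime_factor f0; have [b [g' [ng' gE]]] := prime_factor g0.
have dE w h h' c : h != 0 -> vge w 0 (polyf 'X) -> 0 < w (polyf P) ->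
    ~~ (P %| h') -> h = h' * P ^+ c -> w (polyf h) = w (polyf P) * c%:Z.
  move=> h0 wX wP nh' hE; have h'0 : h' != 0.
    by apply: contraNneq h0 => h'0; rewrite hE h'0 mul0r.
  rewrite hE (dval_polyfM _ h'0) ?expf_neq0// (dval_coprime wX wP nh') add0r.
  by rewrite dval_polyfX pmulrn mulrzz.
rewrite (dE v f f' a)// (dE v g g' b)// (dE u f f' a)// (dE u g g' b)//.
by rewrite -!mulrBr !pmulr_rge0.
Qed.

(** Where ['X] is integral, [P] is a unit; at a pole of ['X] the degree bound excludes a pole of the
    fraction. *)
Lemma not_over_prime u f n : ~ over v u ->
  ((size f).-1 <= n * (size P).-1)%N -> vge u 0 (polyf f / polyf (P ^+ n)).
Proof.
move=> nov sf; have uP : u (polyf P) <= 0.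
  by rewrite leNgt; apply/negP => /over_prime.
have [->|f0] := eqVneq f 0; first by rewrite rmorph0 mul0r; exact: vge0.
have Pn0 : P ^+ n != 0 by rewrite expf_neq0.
right; rewrite (dval_fracf u f0 Pn0) dval_polyfX.
case: (lerP 0 (u (polyf 'X))) => uX.
  have uf : 0 <= u (polyf f) by apply: dval_polyf_ge0; right.
  have -> : u (polyf P) = 0.
    by apply/eqP; rewrite eq_le uP; apply: dval_polyf_ge0; right.
  by rewrite mul0rn subr0.
rewrite (dval_polyf_pole uX f0) (dval_polyf_pole uX P0).
rewrite pmulrn mulrzz -mulrA -mulrBr nmulr_rge0// subr_le0 -PoszM lez_nat.
by rewrite mulnC.
Qed.

Local Notation t := (@FracField.tofrac {poly k}).

(** Bezout for [P ^+ n] and the prime-to-[P] part of the denominator isolates a fraction over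
    [P ^+ n]. Its numerator is reduced modulo [P ^+ n] to avoid a pole at infinity. *)
Lemma split_prime x : exists a b, [/\ x = a + b,
  forall u, ~ over v u -> vge u 0 (ratf a) & vge v 0 (ratf b)].
Proof.
have [f [g [g0 ->]]] := fraction_repr x.
have [n [g' [ng' gE]]] := prime_factor g0.
have g'0 : g' != 0 by apply: contraNneq g0 => g'0; rewrite gE g'0 mul0r.
have [a [b ab]] := bezout_prime n ng'.
have t0 p : p != 0 -> t p != 0 by move=> p0; rewrite tofrac_eq0.
have Pn0 : P ^+ n != 0 by rewrite expf_neq0.
exists (t ((b * f) %% P ^+ n) / t (P ^+ n)).
exists (t (a * f) / t g' + t ((b * f) %/ P ^+ n)); split.
- have E1 : t (b * f) = t ((b * f) %/ P ^+ n) * t (P ^+ n) + t ((b * f) %% P ^+ n).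
    by rewrite -rmorphM -rmorphD -divp_eq.
  have -> : t ((b * f) %% P ^+ n) = t (b * f) - t ((b * f) %/ P ^+ n) * t (P ^+ n).
    by rewrite E1 addrAC subrr add0r.
  have E2 : t a * t (P ^+ n) + t b * t g' = 1 by rewrite -!rmorphM -rmorphD ab rmorph1.
  rewrite gE (rmorphM t g') (rmorphM t b f) (rmorphM t a f).
  exact: (partial_fraction_identity _ _ (t0 _ g'0) (t0 _ Pn0) E2).
- move=> u nov; rewrite ratf_tofrac; apply: not_over_prime => //.
  have := ltn_modpN0 (b * f) Pn0.
  have := size_exp P n; rewrite mulnC => <- h.
  by rewrite -!subn1 leq_sub2r// ltnW.
- have hag : vge v 0 (polyf (a * f) / polyf g').
    apply: vge0Mr; first exact: vge_polyf.
    by right; rewrite (dvalV v (polyf g')) (dval_coprime vX vP ng') oppr0.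
  rewrite (rmorphD ratf); apply: vgeD; last exact: vge_polyf.
  by move: hag; rewrite -ratf_tofrac.
Qed.

Lemma denom_prime x : exists2 D : K, D != 0 &
  forall u, ~ over v u -> vge u 0 (ratf D) /\ vge u 0 (ratf (D * x)).
Proof.
have [f [g [g0 ->]]] := fraction_repr x.
have t0 p : p != 0 -> t p != 0 by move=> p0; rewrite tofrac_eq0.
(* Both [f] and [g] are divided by a power of [P] large enough that neither keeps a pole at
   infinity. *)
pose n := (size f + size g)%N.
have Pn0 : P ^+ n != 0 by rewrite expf_neq0.
have sn p : (size p <= n)%N -> ((size p).-1 <= n * (size P).-1)%N.
  move=> sp; apply: (leq_trans (leq_pred _)); apply: (leq_trans sp).
  by rewrite leq_pmulr// -subn1 subn_gt0 size_prime.
exists (t g / t (P ^+ n)); first by rewrite mulf_neq0 ?invr_eq0 ?t0.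
move=> u nov.
have -> : t g / t (P ^+ n) * (t f / t g) = t f / t (P ^+ n).
  by rewrite mulrC mulrA divfK ?t0.
by rewrite !ratf_tofrac; split; apply: not_over_prime => //; apply: sn;
  rewrite ?leq_addl ?leq_addr.
Qed.

End ZeroOfPrime.

Lemma prime_exists v : vge v 0 (polyf 'X) -> exists P, [/\ P != 0, 0 < v (polyf P) &
  forall p, p != 0 -> 0 < v (polyf p) -> (size P <= size p)%N].
Proof.
move=> vX; have [p [p0 vp]] := dval_nontrivial v.
have vp' : 0 < v (polyf p) by rewrite lt_neqAle eq_sym vp dval_polyf_ge0.
pose Q m := `[< exists p, [/\ p != 0, 0 < v (polyf p) & size p = m] >].
have exQ : exists m, Q m by exists (size p); apply/asboolP; exists p.
case: (ex_minnP exQ) => m /asboolP[P [P0 vP sP]] mmin.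
exists P; split=> // p' p'0 vp''; rewrite sP; apply: mmin.
by apply/asboolP; exists p'.
Qed.

Lemma partial_fraction v x : exists a b, [/\ x = a + b,
  forall u, ~ over v u -> vge u 0 (ratf a) & vge v 0 (ratf b)].
Proof.
have [vX|vX] := ltrP (v (polyf 'X)) 0; first exact: split_pole.
have vX' : vge v 0 (polyf 'X) by right.
by have [P [P0 vP Pmin]] := prime_exists vX'; exact: (split_prime vX' P0 vP Pmin).
Qed.

Lemma denominator v x : exists2 D : K, D != 0 &
  forall u, ~ over v u -> vge u 0 (ratf D) /\ vge u 0 (ratf (D * x)).
Proof.
have [vX|vX] := ltrP (v (polyf 'X)) 0; first exact: denom_pole.
have vX' : vge v 0 (polyf 'X) by right.
by have [P [P0 vP Pmin]] := prime_exists vX'; exact: (denom_prime vX' P0 vP Pmin).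
Qed.

End PlacesOfRationalFunctions.

(** * Cocompactness of the ring of regular elements *)

(** The centers [e] need not come from [A]; each one in use is replaced by an element of [A] related
    to it. This passes from the residues of a field to those of a subfield. *)
Lemma refine_cover (T : eqType) (X : eqType) (E : seq T) (A : set X)
    (rel : X -> T -> Prop) :
  (forall x, A x -> exists2 e, e \in E & rel x e) ->
  exists E' : seq X, (forall x, x \in E' -> A x) /\
    forall x, A x -> exists2 x', x' \in E' & exists2 e, rel x e & rel x' e.
Proof.
move=> cov; have [[x0 Ax0]|noA] := pselect (exists x, A x); last first.
  by exists [::]; split=> // x Ax; case: noA; exists x.
have /choice[rep hrep] : forall e, exists x', (exists x, A x /\ rel x e) ->
    A x' /\ rel x' e.
  move=> e; have [[x' hx']|no] := pselect (exists x, A x /\ rel x e).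
    by exists x'.
  by exists x0.
exists [seq rep e | e <- E & `[< exists x, A x /\ rel x e >]]; split.
  by move=> x /mapP[e]; rewrite mem_filter => /andP[/asboolP /hrep[]] ? ? _ ->.
move=> x Ax; have [e eE xe] := cov x Ax.
have h : exists x, A x /\ rel x e by exists x.
exists (rep e); last by exists e => //; have [] := hrep e h.
by apply: map_f; rewrite mem_filter eE andbT; apply/asboolP.
Qed.

Lemma uniform_pole_bound (K : fieldType) (v : dvaluation K) (E : seq K) :
  exists m : nat, forall x, x \in E -> vge v (- m%:Z) x.
Proof.
elim: E => [|e E [m hm]]; first by exists 0%N.
exists (maxn m `|v e|%N) => x; rewrite inE => /predU1P[->|/hm].
  by right; lia.
by apply: vge_trans; lia.
Qed.

(** * Valuations above one valuation of the base field *)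

Section PlacesOverRationals.
Variables (K : fieldType) (F : fieldExtType K).
Local Notation ratf := (@ratf K F).
Hypothesis dval_nontrivial_ratf :
  forall u : dvaluation F, exists x : K, x != 0 /\ 0 < u (ratf x).
Variable v : dvaluation F.

(** The values of [v] on [K] form a nonzero subgroup of the integers; [e] is its positive generator,
    the ramification index. *)
Lemma restricted_dval : exists (q : dvaluation K) (e : nat),
  (0 < e)%N /\ forall x, v (ratf x) = q x * e%:Z.
Proof.
have [t0 [t0n0 vt0]] := dval_nontrivial_ratf v.
pose Q m := (0 < m)%N && `[< exists x : K, x != 0 /\ v (ratf x) = m%:Z >].
have exQ : exists m, Q m.
  exists `|v (ratf t0)|%N; apply/andP; split; first by lia.
  by apply/asboolP; exists t0; split=> //; lia.
case: (ex_minnP exQ) => e /andP[e0 /asboolP[t [tn0 vt]]] emin.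
have ratf0 x : x != 0 -> ratf x != 0 by rewrite ratf_eq0.
have vdvd x : (e %| v (ratf x))%Z.
  have [->|x0] := eqVneq x 0; first by rewrite rmorph0 dval0 dvdz0.
  rewrite dvdz_eq; apply/eqP.
  set c := (v (ratf x) %/ e)%Z.
  pose y := x / t ^ c.
  have y0 : y != 0 by rewrite mulf_neq0 ?invr_eq0 ?expfz_neq0.
  have vy : v (ratf y) = (v (ratf x) %% e)%Z.
    rewrite fmorph_div fmorphXz dvalM ?invr_eq0 ?expfz_neq0 ?ratf0//.
    rewrite dvalV dvalXz vt {1}(divz_eq (v (ratf x)) e) -/c [e%:Z * c]mulrC.
    by rewrite addrAC subrr add0r.
  have ylt : v (ratf y) < e%:Z by rewrite vy ltz_pmod.
  have yge : 0 <= v (ratf y) by rewrite vy modz_ge0//; lia.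
  have [y_eq0|yn0] := eqVneq (v (ratf y)) 0.
    by rewrite [RHS](divz_eq _ e%:Z) -/c -vy y_eq0 addr0.
  have : (e <= `|v (ratf y)|)%N.
    apply: emin; apply/andP; split; first by lia.
    by apply/asboolP; exists y; split=> //; lia.
  by lia.
pose qf x := (v (ratf x) %/ e)%Z.
have qE x : qf x * e%:Z = v (ratf x) by rewrite divzK.
have e0' : (e%:Z != 0) by lia.
have q0 : qf 0 = 0 by rewrite /qf rmorph0 dval0 div0z.
have qM x y : x != 0 -> y != 0 -> qf (x * y) = qf x + qf y.
  move=> x0 y0; apply: (mulIf e0'); rewrite mulrDl !qE rmorphM dvalM//;
  exact: ratf0.
have qD x y : x != 0 -> y != 0 -> x + y != 0 -> Num.min (qf x) (qf y) <= qf (x + y).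
  move=> x0 y0 xy0; rewrite ge_min.
  have e0'' : 0 < e%:Z by lia.
  rewrite -[qf x <= _](ler_pM2r e0'') -[qf y <= _](ler_pM2r e0'') !qE.
  rewrite rmorphD -ge_min; apply: dvalD; rewrite ?ratf0// -rmorphD.
  exact: ratf0.
have q1 : exists x, qf x = 1.
  by exists t; rewrite /qf vt divzz; case: e e0 {emin vt vdvd qf qE q0 qM qD e0'}.
by exists (DValuation q0 qM qD q1), e; split=> // x; rewrite -qE.
Qed.

Section Restriction.
Variables (q : dvaluation K) (e : nat) (e0 : (0 < e)%N).
Hypothesis qE : forall x, v (ratf x) = q x * e%:Z.

Lemma vge_ratf x : vge q 0 x <-> vge v 0 (ratf x).
Proof.
have [->|x0] := eqVneq x 0; first by rewrite rmorph0; split=> _; exact: vge0.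
have x0' : ratf x != 0 by rewrite ratf_eq0.
have e0' : 0 < e%:Z by lia.
by split=> /(vgeE _ _ _) h; right; move: h; rewrite qE pmulr_lge0//; apply.
Qed.

Lemma over_vge u x : over v u -> vge q 0 x -> vge u 0 (ratf x).
Proof. by move=> ov /vge_ratf; exact: ov. Qed.

Lemma over_unit u x : over v u -> x != 0 -> q x = 0 -> u (ratf x) = 0.
Proof.
move=> ov x0 qx; have x0' : ratf x != 0 by rewrite ratf_eq0.
have xV0 : ratf x^-1 != 0 by rewrite ratf_eq0 invr_eq0.
have /(vgeE _ _ x0') h1 : vge u 0 (ratf x) by apply: over_vge => //; right; rewrite qx.
have /(vgeE _ _ xV0) h2 : vge u 0 (ratf x^-1).
  by apply: over_vge => //; right; rewrite dvalV qx oppr0.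
by apply/eqP; rewrite eq_le h1 andbT -oppr_ge0 -dvalV -fmorphV.
Qed.

Variables (z : K) (qz : q z = 1).

(** If [u (ratf z)] were 0, [u] would be trivial on [K], whose nonzero elements are powers of [z]
    times units of [q]. *)
Lemma over_uniformizer u : over v u -> vge u 1 (ratf z).
Proof.
move=> ov; have z0 := uniformizer_neq0 qz.
have z0' : ratf z != 0 by rewrite ratf_eq0.
have /(vgeE _ _ z0') uz : vge u 0 (ratf z) by apply: over_vge => //; right; rewrite qz.
right; suff : u (ratf z) != 0 by lia.
apply/eqP => uz0; have [x [x0 ux]] := dval_nontrivial_ratf u.
pose y := x / z ^ (q x).
have y0 : y != 0 by rewrite mulf_neq0 ?invr_eq0 ?expfz_neq0.
have qy : q y = 0.
  by rewrite dvalM ?invr_eq0 ?expfz_neq0// dvalV dvalXz qz mul1r subrr.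
have := over_unit ov y0 qy.
have zq0 : ratf (z ^ q x) != 0 by rewrite ratf_eq0 expfz_neq0.
rewrite (fmorph_div ratf) dvalM ?invr_eq0// ?ratf_eq0// dvalV.
by rewrite fmorphXz dvalXz uz0 mul0r subr0 => ux0; move: ux; rewrite ux0 ltxx.
Qed.

Lemma over_submodule g (us : nat -> dvaluation F) m :
  (forall i, (i < g)%N -> over v (us i)) ->
  @valuation_submodule K q F [set x | forall i, (i < g)%N -> vge (us i) m x].
Proof.
move=> ov; split=> [i ig|x y hx hy i ig|a x ha hx i ig] /=.
- exact: vge0.
- by apply: vgeD; [exact: hx|exact: hy].
- by rewrite ratfZ; apply: vge0Ml; [apply: over_vge => //; exact: ov|exact: hx].
Qed.

(** Elements [f i] close to 1 at [us i] and to 0 at the other places are residually free over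
    [q]. *)
Lemma places_bound d g (us : nat -> dvaluation F) : @dependent_above K F d ->
  (forall i, (i < g)%N -> over v (us i)) ->
  (forall i j, (i < g)%N -> (j < g)%N -> i != j -> (us i : F -> int) <> us j) ->
  (g <= d)%N.
Proof.
move=> dep ov dist.
have /choice[f hf] : forall i, exists f, (i < g)%N -> vge (us i) 1 (1 - f) /\
    forall j, (j < g)%N -> j != i -> vge (us j) 1 f.
  move=> i; case: (ltnP i g) => ig; last by exists 0.
  have [|f [f1 fj]] := @approximation _ (us i) (fun j => us (bump i j)) g.-1 1.
    move=> j jg; apply: dist => //; last exact: neq_bump.
    by rewrite /bump; case: (i <= j)%N; move: jg ig; lia.
  exists f => _; split=> // j jg ji.
  have jE : bump i (unbump i j) = j by rewrite unbumpKcond (negPf ji).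
  rewrite -jE; apply: fj; rewrite /unbump; move: ji ig jg; lia.
have subM := over_submodule 0 ov.
set M := [set x | _] in subM.
have [M0 _ _] := subM.
suff fr : residually_free q z M g f by exact: (residually_free_leq M0 dep fr).
split=> [i ig j jg|a a0 [y My sumE] i ig].
  have [f1 fj] := hf i ig.
  have [->|ji] := eqVneq j i; last by apply: (vge_trans _ (fj j jg ji)).
  rewrite -[f i](subKr 1); apply: vgeB; first exact: vge1.
  exact: (vge_trans _ f1).
apply: contrapT => nai; have [ai0 qai] := not_vge nai.
have qai0 : q (a i) = 0 by have /(vgeE _ _ ai0) := a0 i ig; lia.
have uai := over_unit (ov i ig) ai0 qai0.
have ai0' : ratf (a i) != 0 by rewrite ratf_eq0.
have [f1 _] := hf i ig.
have hz : vge (us i) 1 (z *: y).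
  rewrite ratfZ; apply: vge0Mr; last exact: My.
  by apply: over_uniformizer; exact: ov.
(* At [us i] the other terms and [z *: y] lie in the maximal ideal; so does [a i *: f i], although
   [a i] is a unit and [f i] is close to 1. *)
move: sumE; rewrite (bigD1 (Ordinal ig))//= => sumE.
have : vge (us i) 1 (a i *: f i).
  rewrite -[a i *: f i](addrK (\sum_(j < g | j != Ordinal ig) a j *: f j)) sumE.
  apply: vgeB => //; apply: vge_sum => j; rewrite -val_eqE/= => ji.
  rewrite ratfZ; apply: vge0Ml.
    by apply: over_vge; [exact: ov|exact: a0].
  by have [_ fj] := hf j (ltn_ord j); apply: fj => //; rewrite eq_sym.
move=> /(vge0Ml (x := (ratf (a i))^-1)) h.
have : vge (us i) 1 (f i).
  rewrite -[f i](mulKf ai0') -ratfZ; apply: h.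
  by apply: dval_unitV.
move=> /(vgeD f1); rewrite subrK => /(vgeE _ _ (oner_neq0 F)).
by rewrite dval1.
Qed.

(** By [places_bound] there is a longest list of distinct places, and it is exhaustive. Places are
    compared as functions because the records also contain proofs. *)
Lemma finitely_many_places : exists g (us : nat -> dvaluation F),
  (forall i, (i < g)%N -> over v (us i) /\ (v : F -> int) <> us i) /\
  forall u, over v u -> (v : F -> int) <> u ->
    exists2 i, (i < g)%N & (us i : F -> int) = u.
Proof.
have [d dep] : exists d, @dependent_above K F d.
  by eexists; exact: dependent_above_vect.
pose P g := `[< exists us : nat -> dvaluation F,
  (forall i, (i < g)%N -> over v (us i) /\ (v : F -> int) <> us i) /\
  forall i j, (i < g)%N -> (j < g)%N -> i != j -> (us i : F -> int) <> us j >].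
have exP : exists g, P g.
  by exists 0%N; apply/asboolP; exists (fun=> v).
have leP g : P g -> (g <= d)%N.
  move=> /asboolP[us [ov dist]]; apply: (places_bound dep _ dist) => i ig.
  by have [] := ov i ig.
case: (ex_maxnP exP leP) => g /asboolP[us [ov dist]] gmax.
exists g, us; split=> // u ou vu; apply: contrapT => nu.
suff /gmax : P g.+1 by rewrite ltnn.
apply/asboolP; exists (fun i => if (i < g)%N then us i else u); split.
  by move=> i _; case: ifP => [/ov//|_].
have une i : (i < g)%N -> (us i : F -> int) <> u.
  by move=> ig iu; apply: nu; exists i.
move=> i j; rewrite !ltnS => ig jg ij.
case: ltnP => ig'; case: ltnP => jg'.
- exact: dist.
- exact: une.
- by move=> /esym; exact: une.
- move: ij; rewrite (_ : i = j) ?eqxx//; apply/eqP.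
  by rewrite eqn_leq !(leq_trans ig, leq_trans jg).
Qed.

End Restriction.
End PlacesOverRationals.

(** * Approximation by regular elements *)

Section RegularElements.
Variables (K : fieldType) (F : fieldExtType K) (v : dvaluation F).
Local Notation ratf := (@ratf K F).
Hypothesis dval_nontrivial_ratf :
  forall u : dvaluation F, exists x : K, x != 0 /\ 0 < u (ratf x).
Hypothesis partial_fraction : forall x : K, exists a b, [/\ x = a + b,
  forall u, ~ over v u -> vge u 0 (ratf a) & vge v 0 (ratf b)].
Hypothesis denominator : forall x : K, exists2 D : K, D != 0 &
  forall u, ~ over v u -> vge u 0 (ratf D) /\ vge u 0 (ratf (D * x)).

Lemma common_denominator (c : nat -> K) m : exists2 D : K, D != 0 &
  forall u, ~ over v u -> vge u 0 (ratf D) /\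
    forall i, (i < m)%N -> vge u 0 (ratf (D * c i)).
Proof.
elim: m => [|m [D D0 hD]].
  by exists 1; [exact: oner_neq0|move=> u _; rewrite rmorph1; split=> //; exact: vge1].
have [D' D'0 hD'] := denominator (c m).
exists (D * D'); first by rewrite mulf_neq0.
move=> u nov; have [uD uDc] := hD u nov; have [uD' uDc'] := hD' u nov.
split=> [|i]; first by rewrite rmorphM; exact: vge0M.
rewrite ltnS leq_eqVlt => /predU1P[->|im].
  by rewrite -mulrA rmorphM; apply: vge0M.
by rewrite mulrAC rmorphM; apply: vge0M => //; exact: uDc.
Qed.

(* Clear the denominators of an algebraic equation of [t] over [K]. *)
Lemma regular_multiple (t : F) : exists2 D : K, D != 0 &
  forall u, ~ over v u -> vge u 0 (ratf D * t).
Proof.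
have [d dep] : exists d, @dependent_above K F d.
  by eexists; exact: dependent_above_vect.
have [a [[i0 i0d ai0] sum0]] := dep d.+1 (fun i => t ^+ i) (ltnSn _).
have exi : exists i, (i < d.+1)%N && (a i != 0) by exists i0; apply/andP; split.
have lei i : (i < d.+1)%N && (a i != 0) -> (i <= d)%N by move=> /andP[].
case: (ex_maxnP exi lei) => m /andP[md am] mmax.
have [D D0 hD] := common_denominator (fun i => a i / a m) m.
exists D => // u nov; have [uD uDc] := hD u nov.
apply: contrapT => /not_vge; set y := ratf D * t => -[y0 uy].
have tm : a m *: t ^+ m = - \sum_(i < m) a i *: t ^+ i.
  apply/eqP; rewrite -addr_eq0 addrC; apply/eqP; rewrite -[RHS]sum0.
  rewrite -(big_mkord xpredT (fun i => a i *: t ^+ i)).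
  rewrite -[RHS](big_mkord xpredT (fun i => a i *: t ^+ i)).
  rewrite [RHS](@big_cat_nat _ _ _ m.+1)//= big_nat_recr//=.
  rewrite [X in _ = _ + X]big_nat [X in _ = _ + X]big1 ?addr0// => i /andP[mi id].
  have [->|ai] := eqVneq (a i) 0; first by rewrite scale0r.
  by have := mmax i; rewrite id ai leqNgt mi => /(_ isT).
(* After multiplication by [D ^+ m], each coefficient has at least one factor [D], as [i < m], and
   becomes integral at [u]. *)
have ym : y ^+ m = - \sum_(i < m) ratf (D ^+ (m - i).-1 * (D * (a i / a m))) * y ^+ i.
  have -> : y ^+ m = ratf (D ^+ m / a m) * (a m *: t ^+ m).
    rewrite ratfZ mulrA -rmorphM divfK// /y exprMn.
    by rewrite (rmorphXn ratf).
  rewrite tm mulrN; congr (- _); rewrite mulr_sumr; apply: eq_bigr => i _.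
  rewrite ratfZ /y exprMn -(rmorphXn ratf) !mulrA -!(rmorphM ratf); congr (ratf _ * _).
  have -> : D ^+ m = D ^+ (m - i).-1 * D * D ^+ i.
    by rewrite -exprSr prednK ?subn_gt0// -exprD subnK// ltnW.
  by move: (D ^+ _.-1) (D ^+ i) (a m)^-1 => P Q A; ring.
(* At a pole of [y] the right side has order at least [(m - 1) u y], which is more than [m u y], the
   order of the left side. *)
have /(vgeE _ _ _) : vge u (u y * (m%:Z - 1)) (y ^+ m).
  rewrite ym; apply: vgeN; apply: vge_sum => i _; apply: vge0Ml.
    rewrite rmorphM (rmorphXn ratf); apply: vge0M; last exact: uDc.
    exact: vge0X.
  right; rewrite dvalX pmulrn mulrzz ler_wnM2l//; first exact: ltW.
  by have := ltn_ord i; lia.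
rewrite expf_neq0// => /(_ isT); rewrite dvalX pmulrn mulrzz.
by rewrite ler_nM2l//; lia.
Qed.

Lemma vge_same (u u' : dvaluation F) m x : (u : F -> int) = u' ->
  vge u m x -> vge u' m x.
Proof. by rewrite /vge => ->. Qed.

Lemma regular_basis : exists d (b : nat -> F),
  (forall i u, ~ over v u -> vge u 0 (b i)) /\
  forall x, exists a : nat -> K, x = \sum_(i < d) a i *: b i.
Proof.
pose e := vbasis {:F}.
have /choice[D hD] : forall i : nat, exists D : K, D != 0 /\
    forall u, ~ over v u -> vge u 0 (ratf D * e`_i).
  by move=> i; have [D D0 h] := regular_multiple e`_i; exists D.
exists (\dim {:F}), (fun i => D i *: e`_i); split=> [i u nov|x].
  by rewrite ratfZ; have [_] := hD i; apply.
exists (fun i => oapp (fun j => coord e j x) 0 (insub i) / D i).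
rewrite {1}(coord_vbasis (memvf x)); apply: eq_bigr => i _.
have [Di0 _] := hD i.
rewrite scalerA divfK// insubT//= => id; congr (coord _ _ _ *: _).
exact: val_inj.
Qed.

Variable (S : seq F).
Hypothesis residueS :
  forall x, vge v 0 x -> exists2 s, s \in S & vge v 1 (x - s).

(** As [F] is dense in [F_oo], this yields [F_oo = A + ball]. *)
Lemma regular_cocompact_aux : exists m : nat, forall x : F, exists a : F,
  regular_outside v a /\ vge v (- m%:Z) (x - a).
Proof.
have [q [e [e0 qE]]] := restricted_dval dval_nontrivial_ratf v.
have [z qz] := dval_uniformizer q.
have [g [us [ov places]]] := finitely_many_places dval_nontrivial_ratf e0 qE qz.
have ous i : (i < g)%N -> over v (us i) by move=> /ov[].
have [d [b [breg bspan]]] := regular_basis.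
(* [m] bounds the poles of the basis at [v] and the [us j], the only places where it may have
   any. *)
have [m hm] : exists m : nat, forall i, (i < d)%N -> vge v (- m%:Z) (b i) /\
    forall j, (j < g)%N -> vge (us j) (- m%:Z) (b i).
  elim: d {bspan} => [|d [m hm]]; first by exists 0%N.
  have [m1 hm1] := uniform_pole_bound v [:: b d].
  have [m2 hm2] : exists m2 : nat, forall j, (j < g)%N -> vge (us j) (- m2%:Z) (b d).
    exists (\max_(j < g) `|us j (b d)|%N) => j jg; right.
    have := leq_bigmax (F := fun j : 'I_g => `|us j (b d)|%N) (Ordinal jg) => /=; lia.
  exists (maxn m (maxn m1 m2)) => i; rewrite ltnS leq_eqVlt => /predU1P[->|id].
    split=> [|j jg].
      by apply: vge_trans (hm1 (b d) (mem_head _ _)); lia.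
    by apply: vge_trans (hm2 j jg); lia.
  have [h1 h2] := hm i id; split=> [|j jg].
    by apply: vge_trans h1; lia.
  by apply: vge_trans (h2 j jg); lia.
pose M : set F := [set x | forall i, (i < g)%N -> vge (us i) (- m%:Z) x].
have subM : @valuation_submodule K q F M := over_submodule e0 qE (- m%:Z) ous.
have [T hT] : exists T : seq K,
    forall x, vge q 0 x -> exists2 s, s \in T & vge q 1 (x - s).
  have [|T [_ hT]] := @refine_cover F K S [set x : K | vge q 0 x]
      (fun x s => vge v 1 (ratf x - s)).
    by move=> x /(vge_ratf e0 qE) /residueS.
  exists T => x /hT[s sT [c xc sc]]; exists s => //.
  have : vge v 1 (ratf (x - s)).
    rewrite rmorphB; have := vgeB xc sc.
    by rewrite opprB addrA subrK.
  have [->|xs] := eqVneq (x - s) 0; first by left.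
  have xs' : ratf (x - s) != 0 by rewrite ratf_eq0.
  move=> /(vgeE _ _ xs'); rewrite qE => h; right; nia.
have [dK dep] : exists d, @dependent_above K F d.
  by eexists; exact: dependent_above_vect.
have [E hE] := residue_cover_iter qz m dep subM hT.
(* Elements of [z ^+ m *: M] are integral at the [us i], so finitely many principal parts occur;
   each is represented by an element of [M] regular at the places not above. *)
have [|E' [E'A hE']] := @refine_cover F F E
    (M `&` [set x | forall u, ~ over v u -> vge u 0 x])
    (fun x c => forall i, (i < g)%N -> vge (us i) 0 (x - c)).
  move=> x [Mx _]; have [c cE [y My xc]] := hE x Mx.
  exists c => // i ig; rewrite xc ratfZ (rmorphXn ratf).
  have -> : (0 : int) = m%:Z + (- m%:Z) by rewrite subrr.
  apply: vgeM; last exact: My.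
  have /(vgeX m) := over_uniformizer dval_nontrivial_ratf e0 qE qz (ous i ig).
  by rewrite natz.
have [m' hm'] := uniform_pole_bound v E'.
exists (maxn m m') => x.
have [n [n1 n2]] : exists n : nat, - n%:Z <= v x /\
    forall j, (j < g)%N -> - n%:Z <= us j x.
  exists (maxn `|v x| (\max_(j < g) `|us j x|))%N; split; first by lia.
  move=> j jg.
  have := leq_bigmax (F := fun j : 'I_g => `|us j x|%N) (Ordinal jg) => /=; lia.
(* With [n] bounding the poles of [x], this makes [x - c * x] integral at [v] and [c * x] integral
   at the [us i]. *)
have [c [vc uc]] : exists c, vge v n%:Z (1 - c) /\
    forall i, (i < g)%N -> vge (us i) n%:Z c.
  by apply: approximation => i /ov[].
have n0 : (0 : int) = n%:Z + (- n%:Z) by rewrite subrr.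
have vxy : vge v 0 (x - c * x).
  rewrite -[x in x - _]mul1r -mulrBl n0; apply: vgeM => //; by right.
have uy j : (j < g)%N -> vge (us j) 0 (c * x).
  by move=> jg; rewrite n0; apply: vgeM; [exact: uc|right; exact: n2].
have [a yE] := bspan (c * x).
have /choice[p hp] : forall i, exists p : K * K, [/\ a i = p.1 + p.2,
    forall u, ~ over v u -> vge u 0 (ratf p.1) & vge v 0 (ratf p.2)].
  by move=> i; have [p1 [p2 [h1 h2 h3]]] := partial_fraction (a i); exists (p1, p2).
(* The coefficients of [y2] are integral at [v], hence at every place above, so its poles there are
   at most those of the basis. *)
pose y1 := \sum_(i < d) (p i).1 *: b i; pose y2 := \sum_(i < d) (p i).2 *: b i.
have y12 : c * x = y1 + y2.
  rewrite yE -big_split/=; apply: eq_bigr => i _.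
  by have [-> _ _] := hp i; rewrite scalerDl.
have y1reg u : ~ over v u -> vge u 0 y1.
  move=> nov; apply: vge_sum => i _; rewrite ratfZ; apply: vge0M; last exact: breg.
  by have [_ + _] := hp i; apply.
have vy2 : vge v (- m%:Z) y2.
  apply: vge_sum => i _; rewrite ratfZ; apply: vge0Ml.
    by have [_ _] := hp i.
  by have [] := hm i (ltn_ord i).
have uy2 j : (j < g)%N -> vge (us j) (- m%:Z) y2.
  move=> jg; apply: vge_sum => i _; rewrite ratfZ; apply: vge0Ml.
    by have [_ _ h] := hp i; exact: (ous j jg _ h).
  by have [_] := hm i (ltn_ord i); apply.
have My1 : M y1.
  move=> j jg; have -> : y1 = c * x - y2 by rewrite y12 addrK.
  by apply: vgeB; [apply: vge_trans (uy j jg); lia|exact: uy2].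
have [y1' y1'E [c' h1 h2]] := hE' y1 (conj My1 y1reg).
have [My1' y1'reg] := E'A _ y1'E.
(* [y1] and [y1'] have the same principal part at each [us i], so their difference is regular
   outside [v]. *)
exists (y1 - y1'); split.
  apply/asboolP => u /= uv.
  have [ou|nov] := pselect (over v u); last first.
    by apply: vgeB; [exact: y1reg|exact: y1'reg].
  have [i ig usi] := places u ou (fun h => uv (esym h)).
  apply: (vge_same usi).
  by have := vgeB (h1 i ig) (h2 i ig); rewrite opprB addrA subrK.
have -> : x - (y1 - y1') = (x - c * x) + y2 + y1'.
  by rewrite y12; ring.
apply: vgeD; first apply: vgeD.
- by apply: vge_trans vxy; lia.
- by apply: vge_trans vy2; lia.
- by apply: vge_trans (hm' _ y1'E); lia.
Qed.

End RegularElements.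

Lemma regular_cocompact (k : finFieldType) (F : fieldExtType {fraction {poly k}})
    (v : dvaluation F) (S : seq F) :
  (forall x, vge v 0 x -> exists2 s, s \in S & vge v 1 (x - s)) ->
  exists m : nat, forall x : F, exists a : F,
    regular_outside v a /\ vge v (- m%:Z) (x - a).
Proof.
apply: regular_cocompact_aux.
- exact: dval_nontrivial_ratf.
- exact: partial_fraction.
- exact: denominator.
Qed.

(** * Coordinates on the base change *)

(** The universal property of the base change to [F] concerns [F]-spaces; this makes it applicable
    to targets over [E]. *)
Definition restrict_scalars (F E : fieldType) (phi : {rmorphism F -> E})
  (V : lmodType E) : Type := V.

Section RestrictionOfScalars.
Variables (F E : fieldType) (phi : {rmorphism F -> E}) (V : lmodType E).

Local Notation restrict_scalars := (restrict_scalars phi V).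

HB.instance Definition _ := GRing.Zmodule.on restrict_scalars.

Definition restricted_scale (a : F) (x : restrict_scalars) : restrict_scalars :=
  phi a *: (x : V).

Fact restricted_scaleA a b x :
  restricted_scale a (restricted_scale b x) = restricted_scale (a * b) x.
Proof. by rewrite /restricted_scale scalerA rmorphM. Qed.

Fact restricted_scale1 : left_id 1 restricted_scale.
Proof. by move=> x; rewrite /restricted_scale rmorph1 scale1r. Qed.

Fact restricted_scaleDr : right_distributive restricted_scale +%R.
Proof. by move=> a x y; rewrite /restricted_scale scalerDr. Qed.

Fact restricted_scaleDl x : {morph restricted_scale^~ x : a b / a + b}.
Proof. by move=> a b; rewrite /restricted_scale rmorphD scalerDl. Qed.

HB.instance Definition _ := GRing.Zmodule_isLmodule.Build F restrict_scalars
  restricted_scaleA restricted_scale1 restricted_scaleDr restricted_scaleDl.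

Lemma restrict_scalarsZ a (x : restrict_scalars) : a *: x = phi a *: (x : V).
Proof. by []. Qed.

End RestrictionOfScalars.

Section BaseChangeBasis.
Variables (F : fieldType) (v : dvaluation F) (Fv : fieldType).
Variables (iota : {rmorphism F -> Fv}) (L : lmodType (regular_ring v)).
Variables (V : lmodType Fv) (j : {linear L -> V | regular_to v iota \; *:%R}).
Hypothesis jP : is_base_change j.
Variables (n : nat) (rankL : has_rank L n).

Local Notation regval := (\val : {rmorphism regular_ring v -> F}).

(** Transitivity of base change: [V] is [Fv] tensored with [W] over [F]. The [b i] are the images of
    a basis of [W], and [H] extends the coordinates on [L]. *)
Lemma base_change_basis : exists (b : 'I_n -> V) (H : {linear V -> 'rV[Fv]_n}),
  [/\ forall x, x = \sum_(i < n) H x 0 i *: b i,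
      forall i, H (b i) = delta_mx 0 i &
      finitely_generated L -> exists s : seq L, forall x,
        exists c : 'I_(size s) -> Fv, x = \sum_(i < size s) c i *: j s`_i].
Proof.
have [W [jW [jWP dimW]]] := rankL.
pose VF : lmodType F := restrict_scalars iota V.
pose jF : L -> VF := j.
have jF_lin : linear_for (regval \; *:%R) jF.
  by move=> a x y; rewrite /jF linearP.
pose jFl : {linear L -> VF | regval \; *:%R} :=
  HB.pack jF (GRing.isLinear.Build _ _ _ _ jF jF_lin).
have [h hE _] := jWP VF jFl.
have {}hE x : h (jW x) = j x by exact: hE.
subst n.
pose e := vbasis {:W}.
have eW x : x = \sum_(i < \dim {:W}) coord e i x *: e`_i.
  exact: coord_vbasis (memvf x).
pose b i : V := h e`_(i : 'I_(\dim {:W})).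
have jb l : j l = \sum_(i < \dim {:W}) iota (coord e i (jW l)) *: b i.
  rewrite -hE {1}(eW (jW l)) linear_sum; apply: eq_bigr => i _.
  by rewrite linearZ.
pose g : L -> 'rV[Fv]_(\dim {:W}) := fun l => \row_i iota (coord e i (jW l)).
have g_lin : linear_for (regular_to v iota \; *:%R) g.
  move=> a x y; apply/rowP => i; rewrite !mxE linearD linearZ/=.
  by rewrite linearD linearZ/= rmorphD rmorphM.
pose gl : {linear L -> 'rV[Fv]_(\dim {:W}) | regular_to v iota \; *:%R} :=
  HB.pack g (GRing.isLinear.Build _ _ _ _ g g_lin).
have [H HE _] := jP gl.
have {}HE x : H (j x) = \row_i iota (coord e i (jW x)) by exact: HE.
pose comb : 'rV[Fv]_(\dim {:W}) -> V := fun x => \sum_(i < \dim {:W}) x 0 i *: b i.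
have comb_lin : linear comb.
  move=> a x y; rewrite /comb scaler_sumr -big_split/=; apply: eq_bigr => i _.
  by rewrite !mxE scalerDl scalerA.
pose combl : {linear 'rV[Fv]_(\dim {:W}) -> V} :=
  HB.pack comb (GRing.isLinear.Build _ _ _ _ comb comb_lin).
(* Both sides extend [j]; uniqueness for [V] identifies them. *)
have combK x : combl (H x) = x.
  have [idV _ uniq] := jP j.
  have h1 := uniq (combl \o H) _; have h2 := uniq idfun _.
  rewrite -[RHS]/(idfun x) (h2 _ x)//; apply: (h1 _ x) => l /=.
  rewrite HE jb; apply: eq_bigr => i _; by rewrite mxE.
(* [H \o h] and the coordinates on [W] agree on [L]; uniqueness for [W] identifies them. *)
have Hb i : H (b i) = delta_mx 0 i.
  pose RF : lmodType F := restrict_scalars iota 'rV[Fv]_(\dim {:W}).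
  pose f1 : W -> RF := fun x => H (h x).
  have f1_lin : linear f1.
    move=> a x y; rewrite /f1 linearP.
    exact: (linearP H (iota a) (h x : V) (h y : V)).
  pose f1l : {linear W -> RF} := HB.pack f1 (GRing.isLinear.Build _ _ _ _ f1 f1_lin).
  pose f2 : W -> RF := fun x => \row_i iota (coord e i x).
  have f2_lin : linear f2.
    move=> a x y; apply/rowP => k; rewrite !mxE linearD linearZ/=.
    by rewrite rmorphD rmorphM.
  pose f2l : {linear W -> RF} := HB.pack f2 (GRing.isLinear.Build _ _ _ _ f2 f2_lin).
  pose g' : L -> RF := g.
  have g'_lin : linear_for (regval \; *:%R) g'.
    move=> a x y; exact: g_lin.
  pose g'l : {linear L -> RF | regval \; *:%R} :=
    HB.pack g' (GRing.isLinear.Build _ _ _ _ g' g'_lin).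
  have [f _ uniq] := jWP RF g'l.
  have h1 : forall x, f1 x = f x.
    by apply: (uniq f1l) => l; rewrite /= /f1 hE HE.
  have h2 : forall x, f2 x = f x by apply: (uniq f2l) => l.
  rewrite -[LHS]/(f1 e`_i) h1 -h2; apply/rowP => k; rewrite !mxE.
  rewrite coord_free; last exact: basis_free (vbasisP _).
  by rewrite eqxx/= eq_sym; case: eqP => _; rewrite ?rmorph1 ?rmorph0.
exists b, H; split=> // [x|[s sL]]; first by rewrite -[LHS]combK.
exists s.
pose X := [tuple jW s`_(i : 'I_(size s)) | i < size s].
(* The projection onto the span and the identity agree on the image of [L]. *)
have Xfull : <<X>>%VS = fullv.
  pose p := projv <<X>>%VS.
  have [id' _ uniq] := jWP W jW.
  have hp : forall x, p x = id' x.
    apply: (uniq p) => l /=; rewrite /p projv_id//.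
    have [a ->] := sL l; rewrite linear_sum; apply: memv_suml => i _.
    rewrite linearZ/=; apply: memvZ; apply: memv_span.
    by rewrite -(tnth_mktuple (fun t : 'I_(size s) => jW s`_t) i) mem_tnth.
  have hid : forall x, x = id' x by apply: (uniq idfun).
  apply/eqP; rewrite eqEsubv subvf; apply/subvP => x _.
  by rewrite (hid x) -hp memv_proj.
have Xt (t : 'I_(size s)) : X`_t = jW s`_t.
  by rewrite -tnth_nth tnth_mktuple.
have bX i : b i = \sum_(t < size s) iota (coord X t e`_i) *: j s`_t.
  have /coord_span ex : e`_i \in <<X>>%VS by rewrite Xfull memvf.
  rewrite {1}/b {1}ex linear_sum; apply: eq_bigr => t _.
  by rewrite linearZ/= restrict_scalarsZ -hE Xt.
move=> x; exists (fun t => \sum_(i < \dim {:W}) H x 0 i * iota (coord X t e`_i)).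
rewrite -[LHS]combK /= /comb.
transitivity (\sum_(i < \dim {:W}) \sum_(t < size s)
    (H x 0 i * iota (coord X t e`_i)) *: j s`_t).
  apply: eq_bigr => i _; rewrite (bX i) scaler_sumr.
  by apply: eq_bigr => t _; rewrite scalerA.
by rewrite exchange_big; apply: eq_bigr => t _; rewrite scaler_suml.
Qed.

End BaseChangeBasis.

(** * Balls of an ultrametric norm over a complete field *)

Lemma residue_representatives (K : fieldType) (v : dvaluation K) :
  residue_card v != 0%N ->
  exists s : nat -> K, [/\ forall i, (i < residue_card v)%N -> vge v 0 (s i),
    forall x, vge v 0 x -> exists2 i, (i < residue_card v)%N & vge v 1 (x - s i) &
    forall i j, (i < residue_card v)%N -> (j < residue_card v)%N ->
      vge v 1 (s i - s j) -> i = j].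
Proof.
rewrite /residue_card => c0; set A := residue_field v in c0 *.
(* [fset_set] of an infinite set is empty, so a nonzero cardinal certifies finiteness. *)
have finA : finite_set A.
  apply: contrapT => infA; move/eqP: c0; apply; rewrite /fset_set.
  by case: pselect => // _; rewrite cardfs0.
have /choice[rep hrep] : forall C : set K, exists x, A C ->
    vge v 0 x /\ C = [set y | vge v 1 (y - x)].
  move=> C; have [[x x0 <-]|nA] := pselect (A C); first by exists x.
  by exists 0.
pose E : seq (set K) := fset_set A.
have AE C : C \in E -> A C by rewrite in_fset_set// => /set_mem.
have EA C : A C -> C \in E by move=> AC; rewrite in_fset_set//; exact: mem_set.
exists (fun i => rep (nth set0 E i)); split=> [i ig|x x0|i j ig jg ij].
- by have [] := hrep _ (AE _ (mem_nth set0 ig)).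
- pose C := [set y | vge v 1 (y - x)].
  have AC : A C by exists x.
  have [_ CE] := hrep C AC.
  exists (index C E); first by rewrite index_mem; exact: EA.
  rewrite nth_index; last exact: EA.
  have : C x by rewrite /C /= subrr; exact: vge0.
  by rewrite {1}CE.
- apply/eqP; rewrite -(nth_uniq set0 ig jg (fset_uniq _)); apply/eqP.
  have [_ ->] := hrep _ (AE _ (mem_nth set0 ig)).
  have [_ ->] := hrep _ (AE _ (mem_nth set0 jg)).
  rewrite -/E; apply/seteqP; split=> y /= hy.
    by have := vgeD hy ij; rewrite addrA subrK.
  by have := vgeB hy ij; rewrite opprB addrA subrK.
Qed.

Lemma residue_card_gt1 (K : fieldType) (v : dvaluation K) :
  residue_card v != 0%N -> (1 < residue_card v)%N.
Proof.
move=> c0; have [s [s0 scov sinj]] := residue_representatives c0.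
rewrite ltn_neqAle lt0n c0 andbT; apply/eqP => c1.
have [i ic h0] := scov 0 (vge0 v 0); have [k kc h1] := scov 1 (vge1 v).
have : vge v 1 1.
  have ik : i = k by move: ic kc; rewrite -c1; lia.
  by have := vgeB h1 h0; rewrite -ik sub0r opprK subrK.
by move=> /(vgeE _ _ (oner_neq0 K)); rewrite dval1.
Qed.

Section CompletionCocompact.
Variables (k : finFieldType) (F : fieldExtType {fraction {poly k}}).
Variables (v : dvaluation F) (Fv : fieldType) (w : dvaluation Fv).
Variables (iota : {rmorphism F -> Fv}) (compl : is_completion v w iota).
Hypothesis c0 : residue_card w != 0%N.

Lemma vge_iota m x : vge w m (iota x) <-> vge v m x.
Proof.
have [wE _ _] := compl; rewrite /vge wE.
have iE : iota x = 0 <-> x = 0.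
  by split=> [/eqP|->]; [rewrite fmorph_eq0 => /eqP|exact: rmorph0].
by rewrite iE.
Qed.

(** Density reduces the claim to [F], whose residue classes at [v] are covered by those of [w]. *)
Lemma completion_cocompact : exists m : nat, forall x : Fv,
  exists a : regular_ring v, vge w (- m%:Z) (x - iota (val a)).
Proof.
have [s [s0 scov sinj]] := residue_representatives c0.
have [|S [_ hS]] := @refine_cover _ F (map s (seq.iota 0 (residue_card w)))
    [set x | vge v 0 x] (fun x t => vge w 1 (iota x - t)).
  move=> x /(vge_iota 0 x) /scov[i ic xi]; exists (s i) => //.
  by apply: map_f; rewrite mem_iota.
have [|m hm] := @regular_cocompact k F v S.
  move=> x /hS[t tS [y xy ty]]; exists t => //; apply/vge_iota; rewrite rmorphB.
  by have := vgeB xy ty; rewrite opprB addrA subrK.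
exists m => x; have [_ dens _] := compl.
have [y xy] := dens x 0; have [a [areg ya]] := hm y.
exists (RegularRing areg).
have -> : x - iota a = (x - iota y) + iota (y - a) by rewrite rmorphB addrA subrK.
apply: vgeD; first by apply: vge_trans xy; lia.
exact/vge_iota.
Qed.

End CompletionCocompact.

Section NormedSpace.
Variables (R : realType) (K : fieldType) (w : dvaluation K).
Variables (V : lmodType K) (N : V -> R).
Hypothesis normN : ultrametric_norm (vabs R w) N.

Lemma norm_ge0 x : 0 <= N x.
Proof. by have [] := normN. Qed.

Lemma norm_eq0 x : N x = 0 -> x = 0.
Proof. by have [_ h _ _] := normN; case: (h x). Qed.

Lemma norm0 : N 0 = 0.
Proof. by have [_ h _ _] := normN; case: (h 0) => _; apply. Qed.

Lemma normZ a x : N (a *: x) = vabs R w a * N x.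
Proof. by have [_ _ _ ->] := normN. Qed.

Lemma normD_le rho x y : N x <= rho -> N y <= rho -> N (x + y) <= rho.
Proof.
move=> hx hy; have [_ _ h _] := normN; apply: le_trans (h x y) _.
by rewrite ge_max hx hy.
Qed.

Lemma norm_opp x : N (- x) = N x.
Proof.
by rewrite -scaleN1r normZ /vabs oppr_eq0 oner_eq0 dvalN dval1 oppr0 expr0z mul1r.
Qed.

Lemma normB_le rho x y : N x <= rho -> N y <= rho -> N (x - y) <= rho.
Proof. by move=> hx hy; apply: normD_le => //; rewrite norm_opp. Qed.

Lemma norm_sum_le rho (I : Type) (s : seq I) (P : pred I) (f : I -> V) :
  0 <= rho -> (forall i, P i -> N (f i) <= rho) -> N (\sum_(i <- s | P i) f i) <= rho.
Proof.
move=> rho0 h; elim/big_ind: _ => //; first by rewrite norm0.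
by move=> x y; exact: normD_le.
Qed.

(** For [residue_card w = 0] the junk absolute value [vabs] vanishes on
    uniformizers, which no norm on a nonzero space allows. *)
Lemma residue_card_neq0 (x : V) : x != 0 -> residue_card w != 0%N.
Proof.
move=> x0; apply/eqP => c0; have [z wz] := dval_uniformizer w.
have z0 := uniformizer_neq0 wz.
have : N (z *: x) = 0.
  by rewrite normZ /vabs (negPf z0) wz c0 exprN1 invr0 mul0r.
by move=> /norm_eq0 /eqP; rewrite scaler_eq0 (negPf z0) (negPf x0).
Qed.

Local Notation c := ((residue_card w)%:R : R).
Hypothesis c0 : residue_card w != 0%N.

Lemma residue_cardR_gt1 : 1 < c.
Proof. by rewrite ltr1n; exact: residue_card_gt1. Qed.

Lemma residue_cardR_gt0 : 0 < c.
Proof. exact: lt_trans ltr01 residue_cardR_gt1. Qed.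

Lemma residue_cardR_neq0 : c != 0.
Proof. by rewrite gt_eqF// residue_cardR_gt0. Qed.

Lemma vabs_le m (a : K) : vge w m a -> vabs R w a <= c ^ (- m).
Proof.
move=> [->|h]; first by rewrite /vabs eqxx exprz_ge0// ltW// residue_cardR_gt0.
rewrite /vabs; case: ifP => _; first by rewrite exprz_ge0// ltW// residue_cardR_gt0.
by rewrite ler_weXz2l ?lerN2// ltW// residue_cardR_gt1.
Qed.

Lemma vabs_dval (a : K) : a != 0 -> vabs R w a = c ^ (- w a).
Proof. by rewrite /vabs => /negPf ->. Qed.

Lemma normZ_le m a rho x : vge w m a -> N x <= rho -> N (a *: x) <= c ^ (- m) * rho.
Proof.
move=> ha hx; rewrite normZ; apply: ler_pM => //; last exact: vabs_le.
- rewrite /vabs; case: ifP => // _; exact: exprz_ge0 (ltW residue_cardR_gt0).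
- exact: norm_ge0.
Qed.

Lemma ball_submodule rho : 0 <= rho -> valuation_submodule w [set x | N x <= rho].
Proof.
move=> rho0; split=> [|x y|a x a0 hx] /=.
- by rewrite norm0.
- exact: normD_le.
- by have := normZ_le a0 hx; rewrite oppr0 expr0z mul1r.
Qed.

Lemma residue_card_pow_large (x : R) : exists m : nat, x < c ^+ m.
Proof.
exists (Num.Def.archi_bound `|x|); apply: le_lt_trans (ler_norm x) _.
apply: lt_trans (archi_boundP (normr_ge0 x)) _.
by rewrite -natrX ltr_nat ltn_expl// residue_card_gt1.
Qed.

Variables (z : K) (wz : w z = 1).

Lemma norm_uniformizer (x : V) m : N (z ^ m *: x) = c ^ (- m) * N x.
Proof.
have z0 := uniformizer_neq0 wz.
by rewrite normZ vabs_dval ?expfz_neq0// dvalXz wz mul1r.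
Qed.

Lemma norm_small rho (x : V) : (forall m : nat, N x <= c ^ (- m%:Z) * rho) -> x = 0.
Proof.
move=> h; apply: norm_eq0; apply: contrapT => /eqP Nx0.
have Nx : 0 < N x by rewrite lt_neqAle eq_sym Nx0 norm_ge0.
have [m hm] := residue_card_pow_large (rho / N x).
have := h m; rewrite -exprnN ler_pdivlMl ?exprn_gt0 ?residue_cardR_gt0//.
by rewrite leNgt -ltr_pdivrMr// hm.
Qed.

Hypothesis K_complete : forall u : nat -> K,
  (forall m : int, exists N : nat, forall p q : nat,
     (N <= p)%N -> (N <= q)%N -> vge w m (u p - u q)) ->
  exists l : K, forall m : int, exists N : nat, forall p : nat,
     (N <= p)%N -> vge w m (u p - l).

(* Successive approximation: the coefficients of the expansions of [x] modulo
   [z ^ t] converge in the complete field. *)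
Lemma complete_generation rho g (f : nat -> V) : 0 <= rho ->
  (forall i, (i < g)%N -> N (f i) <= rho) ->
  (forall x, N x <= rho -> exists a y, [/\ forall i, (i < g)%N -> vge w 0 (a i),
     N y <= rho & x = \sum_(i < g) a i *: f i + z *: y]) ->
  forall x, N x <= rho -> exists a : nat -> K, x = \sum_(i < g) a i *: f i.
Proof.
move=> rho0 Mf gen x Mx.
have z0 := uniformizer_neq0 wz.
have /choice[step hstep] : forall x, exists ay : (nat -> K) * V, N x <= rho ->
    [/\ forall i, (i < g)%N -> vge w 0 (ay.1 i), N ay.2 <= rho &
        x = \sum_(i < g) ay.1 i *: f i + z *: ay.2].
  move=> y; have [/gen[a [y' h]]|ny] := pselect (N y <= rho).
    by exists (a, y').
  by exists (fun=> 0, 0).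
pose xs t := iter t (fun y => (step y).2) x.
have Mxs t : N (xs t) <= rho.
  by elim: t => [|t IH] //=; have [] := hstep _ IH.
pose A t i := \sum_(s < t) z ^+ s * (step (xs s)).1 i.
have xE t : x = \sum_(i < g) A t i *: f i + z ^+ t *: xs t.
  elim: t => [|t IH].
    rewrite expr0 scale1r big1 ?add0r// => i _.
    by rewrite /A big_ord0 scale0r.
  have [_ _ e] := hstep _ (Mxs t).
  rewrite {1}IH {1}e scalerDr addrA scalerA -exprSr; congr (_ + _).
  rewrite scaler_sumr -big_split/=; apply: eq_bigr => i _.
  by rewrite /A big_ord_recr/= scalerDl scalerA.
have vz t : vge w t%:Z (z ^+ t) by right; rewrite dvalX wz natz.
have Acauchy i t d : (i < g)%N -> vge w t%:Z (A (t + d)%N i - A t i).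
  move=> ig; rewrite /A big_split_ord/= addrAC subrr add0r.
  apply: vge_sum => s _; apply: vge0Mr.
    by apply: (vge_trans _ (vz _)) => /=; lia.
  by have [h _ _] := hstep _ (Mxs (t + s)%N); exact: h.
have /choice[l hl] : forall i, exists l : K, (i < g)%N -> forall t : nat,
    vge w t%:Z (A t i - l).
  move=> i; case: (ltnP i g) => ig; last by exists 0.
  have [|l hl] := @K_complete (fun t => A t i).
    move=> m; exists `|m|%N => p q hp hq.
    have := vgeB (Acauchy i `|m|%N (p - `|m|)%N ig) (Acauchy i `|m|%N (q - `|m|)%N ig).
    rewrite !subnKC// opprB addrA subrK; apply: vge_trans; lia.
  (* Completeness gives convergence without a rate; comparison with a far term yields precision
     [t]. *)
  exists l => _ t; have [M hM] := hl t.
  have -> : A t i - l = (A (t + M)%N i - l) - (A (t + M)%N i - A t i) by ring.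
  by apply: vgeB; [exact: hM (leq_addl t M)|exact: Acauchy].
exists l; apply/eqP; rewrite -subr_eq0; apply/eqP; apply: (@norm_small rho) => t.
rewrite {1}(xE t) addrAC -sumrB; apply: normD_le.
  apply: norm_sum_le; first by rewrite mulr_ge0// exprz_ge0// ltW// residue_cardR_gt0.
  move=> i _; rewrite -scalerBl; apply: normZ_le; last exact: Mf.
  exact: hl.
by apply: normZ_le.
Qed.

Lemma ball_absorbs rho x : 0 < rho -> exists m : nat, N (z ^+ m *: x) <= rho.
Proof.
move=> rho0; have [m hm] := residue_card_pow_large (N x / rho).
exists m; rewrite exprnP norm_uniformizer -exprnN.
by rewrite ler_pdivrMl ?exprn_gt0 ?residue_cardR_gt0// -ler_pdivrMr// ltW.
Qed.

Variables (n : nat) (b : 'I_n -> V) (H : {linear V -> 'rV[K]_n}).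
Hypothesis bE : forall x, x = \sum_(i < n) H x 0 i *: b i.
Hypothesis Hb : forall i, H (b i) = delta_mx 0 i.

Lemma coordinates_inj : injective H.
Proof. by move=> x y xy; rewrite (bE x) (bE y) xy. Qed.

(** The [g] coordinate rows of the [f i] span the whole row space, of dimension [n]. *)
Lemma generating_geq g (f : nat -> V) :
  (forall x, exists a : nat -> K, x = \sum_(i < g) a i *: f i) -> (n <= g)%N.
Proof.
move=> gen; pose A := \matrix_(i < g) H (f i).
have : (1%:M <= A)%MS.
  apply/row_subP => i; rewrite row1 -Hb; have [a ->] := gen (b i).
  rewrite linear_sum; apply: summx_sub => t _; rewrite linearZ/=.
  apply: scalemx_sub; rewrite (_ : H (f t) = row t A) ?row_sub//.
  by rewrite rowK.
by move=> /mxrankS; rewrite mxrank1 => /leq_trans; apply; exact: rank_leq_row.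
Qed.

(** With [complete_generation], the [f i] form a basis of the ball over the
    valuation ring, whence their number. *)
Lemma ball_residual_basis rho : 0 < rho -> exists f : nat -> V,
  residually_free w z [set x | N x <= rho] n f /\
  forall x, N x <= rho -> exists a y, [/\ forall i, (i < n)%N -> vge w 0 (a i),
     N y <= rho & x = \sum_(i < n) a i *: f i + z *: y].
Proof.
move=> rho0; have rho0' := ltW rho0.
have dep : dependent_above V n.
  exact: dependent_above_inj coordinates_inj (@dependent_above_rV K n).
have subM := ball_submodule rho0'.
have [g [f [fr gen]]] := residual_basis wz dep subM.
suff gn : g = n by exists f; rewrite -gn.
apply/eqP; rewrite eqn_leq; apply/andP; split.
  by apply: (residually_free_leq _ dep fr); have [] := subM.
apply: (@generating_geq g f) => x.
have [m hm] := ball_absorbs x rho0.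
have [a aE] := complete_generation rho0' (proj1 fr) gen hm.
exists (fun i => (z ^+ m)^-1 * a i).
have zm0 : z ^+ m != 0 by rewrite expf_neq0// (uniformizer_neq0 wz).
rewrite -[LHS](scalerK zm0) aE scaler_sumr; apply: eq_bigr => i _.
by rewrite scalerA.
Qed.

End NormedSpace.

(** * Fundamental domains *)

Section UltrametricMeasure.
Variables (R : realType) (V : zmodType) (N : V -> R).
Hypothesis N0 : N 0 = 0.
Hypothesis NB : forall rho x y, N x <= rho -> N y <= rho -> N (x - y) <= rho.
Implicit Types (E : set (borel N)) (x y : V) (rho : R).

Definition norm_ball rho : set (borel N) := [set x : V | N x <= rho].

Definition shift x E : set (borel N) := [set (x + y : V) | y in E].

Lemma shiftP x E y : shift x E y <-> E (y - x).
Proof.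
split=> [[u Eu <-]|Ey]; first by rewrite addrC addKr.
by exists (y - x) => //; rewrite addrC subrK.
Qed.

Lemma ultranormBC x y : N (x - y) = N (y - x).
Proof.
have h u : N (- u) <= N u.
  have h0 : N 0 <= Num.max (N u) 0 by rewrite N0 le_max lexx orbT.
  have := @NB (Num.max (N u) 0) 0 u h0; rewrite sub0r.
  case: (leP (N u) 0) => hu; last by apply.
  move=> _; have := @NB (N u) u u (lexx _) (lexx _); rewrite subrr N0 => u0.
  by have := @NB (N u) 0 u; rewrite sub0r N0; apply.
apply/eqP; rewrite eq_le -{1}opprB h /=.
by rewrite -[in leLHS]opprB h.
Qed.

Lemma ultranormN x : N (- x) = N x.
Proof. by rewrite -[- x]sub0r ultranormBC subr0. Qed.

Lemma ultranormD rho x y : N x <= rho -> N y <= rho -> N (x + y) <= rho.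
Proof.
move=> hx hy; rewrite -[y]opprK; apply: NB => //.
by rewrite ultranormN.
Qed.

Lemma measurable_norm_open (U : set V) : norm_open N U ->
  measurable (U : set (borel N)).
Proof. by move=> oU; apply: sub_sigma_algebra. Qed.

Lemma measurable_shift x E : measurable E -> measurable (shift x E).
Proof.
move=> mE; pose f : borel N -> borel N := fun y : V => y - x.
have mf : measurable_fun setT f.
  apply: (@measurability _ _ (borel N) (borel N) setT f (norm_open N)) =>
    [|_ [U oU <-]]; first by [].
  rewrite setTI; apply: measurable_norm_open => y Uy.
  have [e e0 he] := oU _ Uy; exists e => // y' hy'; apply: he.
  by rewrite opprB addrA subrK.
have -> : shift x E = setT `&` f @^-1` E.
  by rewrite setTI; apply/seteqP; split=> y /shiftP.
exact: mf.
Qed.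

(** Such a set is a union of cosets of a ball, hence open. *)
Lemma measurable_cosets rho (U : set V) : 0 < rho ->
  (forall x y, U x -> N (y - x) <= rho -> U y) -> measurable (U : set (borel N)).
Proof.
move=> rho0 h; apply: measurable_norm_open => x Ux; exists rho => // y hy.
by apply: (h x) => //; exact: ltW.
Qed.

Lemma measurable_ball rho : 0 < rho ->
  measurable (norm_ball rho).
Proof.
move=> rho0; apply: (measurable_cosets rho0) => x y /= hx hy.
by rewrite -[y](subrK x); apply: ultranormD.
Qed.

Variable mu : {measure set (borel N) -> \bar R}.
Hypothesis mu_shift : forall x E, measurable E -> mu (shift x E) = mu E.

Lemma fsum_const (I : choiceType) (D : set I) (a : \bar R) : finite_set D ->
  (\sum_(i \in D) a = (#|` fset_set D|%:R)%:E * a)%E.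
Proof.
move=> finD; rewrite fsbig_finite//= big_const_seq count_predT.
elim: (size _) => [|m IH]; first by rewrite mul0e.
rewrite iterS IH -natr1 EFinD [RHS]ge0_muleDl ?lee_fin// ?ler0n// mul1e.
by rewrite addeC.
Qed.

Lemma mu_shifts (I : choiceType) (D : set I) (t : I -> V) E :
  finite_set D -> measurable E -> trivIset D (fun i => shift (t i) E) ->
  mu (\bigcup_(i in D) shift (t i) E) = ((#|` fset_set D|%:R)%:E * mu E)%E.
Proof.
move=> finD mE tD; rewrite measure_fin_bigcup//; last first.
  by move=> i _; exact: measurable_shift.
rewrite -fsum_const//; apply: eq_fsbigr => i _; exact: mu_shift.
Qed.

Lemma mu_shifts_le (I : choiceType) (D : set I) (t : I -> V) E (B : set (borel N)) :
  finite_set D -> measurable E -> measurable B ->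
  B `<=` \bigcup_(i in D) shift (t i) E ->
  (mu B <= (#|` fset_set D|%:R)%:E * mu E)%E.
Proof.
move=> finD mE mB BE; rewrite -fsum_const//.
have -> : (\sum_(i \in D) mu E)%E = (\sum_(i \in D) mu (shift (t i) E))%E.
  by apply: eq_fsbigr => i _; rewrite mu_shift.
by apply: content_sub_fsum => // i _; exact: measurable_shift.
Qed.

Section FundamentalDomains.
Variables (G : set V) (subgroup0 : G 0) (subgroupB : forall x y, G x -> G y -> G (x - y)).

Lemma subgroupD x y : G x -> G y -> G (x + y).
Proof.
move=> Gx Gy; rewrite -[y]opprK; apply: subgroupB => //.
by rewrite -[- y]sub0r; exact: subgroupB.
Qed.

(* [D] is cut along the cosets of [B = {N <= rho}] that meet [G]; shifting the
   pieces back into [B] yields a set [C] with [mu C <= mu D] whose translates by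
   [G `&` B] cover [B]. *)
Lemma mu_ball_le_domain rho (I : choiceType) (S : set I) (t : I -> V)
    (D : set (borel N)) :
  0 < rho -> countable G -> fundamental_domain G D -> finite_set S ->
  G `&` norm_ball rho `<=` t @` S ->
  (mu (norm_ball rho) <= (#|` fset_set S|%:R)%:E * mu D)%E.
Proof.
move=> rho0 cG [mD domD] finS GS; set B := norm_ball rho.
have mB : measurable B := measurable_ball rho0.
have [h hG] : exists h : nat -> V,
    (forall k, G (h k)) /\ forall x, G x -> exists k, h k = x.
  have [f finj] : exists f : V -> nat, {in G &, injective f}.
    by move/countable_injP: cG => [f]; exists f.
  have /choice[h hh] : forall k, exists x, G x /\ ((exists2 y, G y & f y = k) -> f x = k).
    move=> k; have [[y Gy yk]|no] := pselect (exists2 y, G y & f y = k).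
      by exists y.
    by exists 0; split=> // -[y Gy yk]; case: no; exists y.
  exists h; split=> [k|x Gx]; first by have [] := hh k.
  exists (f x); have [Gh hf] := hh (f x).
  by apply: finj; rewrite ?inE//; apply: hf; exists x.
have [Gh hs] := hG.
(* Selects one index for each coset of [B] meeting [G], since [h] may visit a coset many times; this
   makes the pieces [P k] disjoint. *)
pose first k := `[< forall l, (l < k)%N -> ~ B (h l - h k) >].
pose P k : set (borel N) := if first k then D `&` shift (h k) B else set0.
pose C : set (borel N) := \bigcup_k shift (- h k) (P k).
have mP k : measurable (P k).
  by rewrite /P; case: ifP => _ //; apply: measurableI => //; exact: measurable_shift.
have mC : measurable C.
  by apply: bigcupT_measurable => k; exact: measurable_shift.
have tP : trivIset setT P.
  move=> k l _ _ [x []]; rewrite /P.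
  case: ifP => // /asboolP fk; case: ifP => [|_ _ []] // /asboolP fl.
  move=> [_ /shiftP xk] [_ /shiftP xl].
  have hkl : B (h k - h l).
    by have := NB xl xk; rewrite opprB addrC addrA subrK.
  have hlk : B (h l - h k) by rewrite /B /norm_ball/= ultranormBC.
  case: (ltngtP k l) => // kl; first by case: (fl k kl).
  by case: (fk l kl).
have muC : (mu C <= mu D)%E.
  apply: (@le_trans _ _ (\sum_(0 <= k <oo) mu (shift (- h k) (P k)))%E).
    by apply: measure_sigma_subadditive => // k; exact: measurable_shift.
  under eq_eseriesr do rewrite mu_shift//.
  have -> : (\sum_(0 <= k <oo) mu (P k) = mu (\bigcup_k P k))%E.
    rewrite measure_bigcup//; apply: eq_eseriesl => k.
    by rewrite in_setT.
  apply: le_measure; rewrite ?inE//; first exact: bigcupT_measurable.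
  by move=> x [k _]; rewrite /P; case: ifP => // _ [].
apply: (@le_trans _ _ ((#|` fset_set S|%:R)%:E * mu C)%E); last first.
  by apply: lee_pmul => //; rewrite lee_fin.
apply: (mu_shifts_le (t := t) finS mC mB) => x Bx.
(* The point [x - g] of [D] lies in the coset of [- g]. If [k] is the index selected for it,
   [h k + g] is one of the [t i] and shifts a point of [C] to [x]. *)
have [g [[Gg Dxg] _]] := domD x.
have GNg : G (- g) by rewrite -[- g]sub0r; exact: subgroupB.
have exk : exists k, `[< B (h k + g) >].
  have [k hk] := hs _ GNg; exists k; apply/asboolP.
  by rewrite hk addNr /B /norm_ball/= N0 ltW.
case: (ex_minnP exk) => k /asboolP Bk kmin.
have fk : first k.
  apply/asboolP => l lk Blk; have : B (h l + g).
    by rewrite -[h l](subrK (h k)) -addrA; apply: ultranormD.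
  by move=> /asboolP /kmin; rewrite leqNgt lk.
have [i Si ti] : (t @` S) (h k + g).
  by apply: GS; split=> //; exact: subgroupD.
exists i => //; apply/shiftP; exists k => //; apply/shiftP; rewrite ti /P fk.
have -> : x - (h k + g) - - h k = x - g by rewrite opprK [h k + g]addrC opprD addrA subrK.
split=> //; apply/shiftP.
have -> : x - g - h k = x - (h k + g) by rewrite [h k + g]addrC opprD addrA.
exact: NB.
Qed.

(* The domain consists of one coset of [norm_ball rho1] for each class modulo
   [G + norm_ball rho1]; no two of its points differ by an element of [G] because
   [G] meets this ball trivially. *)
Lemma domain_in_ball rho rho1 (I : choiceType) (S : set I) (t : I -> V) :
  0 < rho1 -> rho1 <= rho -> (forall g, G g -> N g <= rho1 -> g = 0) ->
  (forall x, exists2 g, G g & N (x - g) <= rho) -> finite_set S ->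
  (forall i, S i -> G (t i) /\ N (t i) <= rho) ->
  {in S &, injective t} ->
  exists2 D : set (borel N), fundamental_domain G D &
    ((#|` fset_set S|%:R)%:E * mu D <= mu (norm_ball rho))%E.
Proof.
move=> rho1_gt0 rho1rho disc cov finS St tinj.
pose rel x y := exists2 g, G g & N (x - y - g) <= rho1.
have rel_sym x y : rel x y -> rel y x.
  move=> [g Gg h]; exists (- g); first by rewrite -[- g]sub0r; exact: subgroupB.
  have -> : y - x - - g = - (x - y - g) by rewrite opprB opprB opprK addrC.
  by rewrite ultranormN.
have rel_trans x y u : rel x y -> rel y u -> rel x u.
  move=> [g Gg h] [g' Gg' h']; exists (g + g'); first exact: subgroupD.
  have -> : x - u - (g + g') = (x - y - g) + (y - u - g').
    by rewrite addrACA -opprD; congr (_ - _); rewrite addrA subrK.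
  exact: ultranormD.
(* [xget] depends only on the set, so equivalent points receive the same representative. *)
pose rep x := xget 0 [set y | rel x y /\ N y <= rho].
have repP x : rel x (rep x) /\ N (rep x) <= rho.
  rewrite /rep; case: xgetP => [y -> //|]; have [g Gg hg] := cov x.
  move=> /(_ (x - g)); case; split=> //; exists g => //.
  by rewrite opprB addrCA subrr addr0 subrr N0 ltW.
have rep_rel x y : rel x y -> rep x = rep y.
  move=> xy; rewrite /rep; congr (xget _ _); apply/seteqP; split=> u [h hu];
    split=> //; apply: rel_trans h => //; exact: rel_sym.
have relG x g : G g -> rel x (x - g).
  by move=> Gg; exists g => //; rewrite opprB addrCA subrr addr0 subrr N0 ltW.
pose D : set (borel N) := [set x : V | N (x - rep x) <= rho1].
have mD : measurable D.
  apply: (measurable_cosets rho1_gt0) => x y Dx xy; rewrite /D /=.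
  have -> : y - rep y = (y - x) + (x - rep x).
    rewrite addrA subrK; congr (_ - _); apply: rep_rel.
    by exists 0 => //; rewrite subr0.
  exact: ultranormD.
have Duniq x g g' : G g -> G g' -> D (x - g) -> D (x - g') -> g = g'.
  move=> Gg Gg'; rewrite /D /= -(rep_rel _ _ (relG x g Gg)).
  rewrite -(rep_rel _ _ (relG x g' Gg')) => h h'; apply/eqP; rewrite -subr_eq0.
  apply/eqP/disc; first exact: subgroupB.
  have := NB h' h; congr (N _ <= _).
  by rewrite opprB addrA subrK opprB addrC addrA subrK.
exists D.
  split=> // x; have [[g Gg hg] _] := repP x.
  exists g; split=> [|g' [Gg' Dg']]; last apply: Duniq Dg' => //.
    by split=> //; rewrite /D /= -(rep_rel _ _ (relG x g Gg)) addrAC.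
  by rewrite /D /= -(rep_rel _ _ (relG x g Gg)) addrAC.
rewrite -(mu_shifts (t := t))//.
  apply: le_measure; rewrite ?inE.
  - apply: fin_bigcup_measurable => // i _; exact: measurable_shift.
  - by apply: measurable_ball; exact: lt_le_trans rho1rho.
  - move=> x [i Si /shiftP Dx]; have [_ ti] := St i Si.
    rewrite /norm_ball/= -[x](subrK (t i)); apply: ultranormD => //.
    have [_ hr] := repP (x - t i).
    rewrite -[x - t i](subrK (rep (x - t i))); apply: ultranormD => //.
    exact: le_trans Dx rho1rho.
move=> i i' Si Si' [x [/shiftP h /shiftP h']].
have [Gt _] := St i Si; have [Gt' _] := St i' Si'.
by apply: tinj; rewrite ?inE//; exact: Duniq h h'.
Qed.

End FundamentalDomains.
End UltrametricMeasure.

(** * Counting lattice points *)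

Section LatticePoints.
Variables (R : realType) (K : fieldType) (w : dvaluation K).
Variables (V : lmodType K) (N : V -> R).
Hypothesis normN : ultrametric_norm (vabs R w) N.
Hypothesis c0 : residue_card w != 0%N.
Local Notation c := ((residue_card w)%:R : R).
Hypothesis K_complete : forall u : nat -> K,
  (forall m : int, exists N : nat, forall p q : nat,
     (N <= p)%N -> (N <= q)%N -> vge w m (u p - u q)) ->
  exists l : K, forall m : int, exists N : nat, forall p : nat,
     (N <= p)%N -> vge w m (u p - l).
Variables (n : nat) (b : 'I_n -> V) (H : {linear V -> 'rV[K]_n}).
Hypothesis bE : forall x, x = \sum_(i < n) H x 0 i *: b i.
Hypothesis Hb : forall i, H (b i) = delta_mx 0 i.
Variables (r : R) (r_gt0 : 0 < r) (mu : {measure set (borel N) -> \bar R}).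
Hypothesis haar_mu : normalized_haar r mu.

Local Notation rho i := (r * c ^ i).
Local Notation ball := (@norm_ball R V N).

Lemma radius_gt0 (i : int) : 0 < rho i.
Proof. by rewrite mulr_gt0// exprz_gt0// residue_cardR_gt0. Qed.

Lemma radius_le (i k : int) : i <= k -> rho i <= rho k.
Proof.
by move=> ik; rewrite ler_pM2l// ler_weXz2l// ltW// residue_cardR_gt1.
Qed.

Lemma radiusD (i k : int) : rho (i + k) = c ^ k * rho i.
Proof. by rewrite expfzDr ?(residue_cardR_neq0 R c0)// mulrA [RHS]mulrC. Qed.

Let N0 : N 0 = 0 := norm0 normN.
Let NB rho x y : N x <= rho -> N y <= rho -> N (x - y) <= rho :=
  @normB_le _ _ _ _ _ normN rho x y.
Let mu_shift (x : V) (E : set (borel N)) :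
  measurable E -> mu (shift x E) = mu E := proj1 haar_mu x E.

(** The smaller ball is [z] times the larger one; its cosets are represented by the [c ^ n]
    combinations of a residual basis with residue representatives as coefficients. *)
Lemma mu_ball_step (i : int) :
  mu (ball (rho i)) = ((c ^+ n)%:E * mu (ball (rho (i - 1))))%E.
Proof.
have [z wz] := dval_uniformizer w.
have [s [s0 scov sinj]] := residue_representatives c0.
have rho0 := radius_gt0 i.
have [f [[Mf fr] gen]] :=
  ball_residual_basis normN c0 wz K_complete bE Hb rho0.
pose I := {ffun 'I_n -> 'I_(residue_card w)}.
pose t (a : I) := \sum_(k < n) s (a k) *: f k.
have rhoE : rho (i - 1) = c ^ (-1) * rho i by rewrite radiusD.
have cardI : #|` fset_set [set: I]| = (residue_card w ^ n)%N.
  have -> : fset_set [set: I] = [fset x in enum {: I}]%fset.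
    apply/fsetP => x; rewrite in_fset_set ?in_setT ?inE ?mem_enum//.
    exact: finite_finset.
  by rewrite card_fseq undup_id ?enum_uniq// -cardE card_ffun !card_ord.
have tball a : N (t a) <= rho i.
  apply: (norm_sum_le normN) => [|k _]; first exact: ltW.
  have := normZ_le normN c0 (s0 _ (ltn_ord (a k))) (Mf k (ltn_ord k)).
  by rewrite oppr0 expr0z mul1r.
have -> : ball (rho i) =
    \bigcup_(a in [set: I]) shift (t a) (ball (rho (i - 1))).
  apply/seteqP; split=> x; last first.
    move=> [a _ /shiftP hx]; rewrite /norm_ball/= -[x](subrK (t a)).
    apply: (normD_le normN) (tball a); apply: le_trans hx (radius_le _).
    by lia.
  move=> /gen[a [y [a0 Ny xE]]].
  have /choice[k hk] : forall l : 'I_n, exists k : 'I_(residue_card w),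
      vge w 1 (a l - s k).
    by move=> l; have [k kc h] := scov _ (a0 l (ltn_ord l)); exists (Ordinal kc).
  exists [ffun l => k l] => //; apply/shiftP; rewrite /norm_ball/= rhoE.
  rewrite xE addrAC /t -sumrB; apply: (normD_le normN).
    apply: (norm_sum_le normN) => [|l _].
      by rewrite mulr_ge0 ?(ltW rho0)// exprz_ge0// ltW// residue_cardR_gt0.
    rewrite -scalerBl ffunE; apply: (normZ_le normN c0); first exact: hk.
    exact: Mf.
  by apply: (normZ_le normN c0) => //; right; rewrite wz.
rewrite (mu_shifts mu_shift) ?cardI ?natrX//.
- exact: finite_finset.
- by apply: (measurable_ball N0 NB); exact: radius_gt0.
(* If two translates meet, [t a - t a'] lies in [z] times the ball, and residual freeness makes the
   coefficients congruent, hence equal. *)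
- move=> a a' _ _ [x [/shiftP hx /shiftP hx']].
  have hN : N (z ^ (-1) *: (t a - t a')) <= rho i.
    rewrite (norm_uniformizer normN wz) opprK expr1z.
    have := NB hx' hx; rewrite /norm_ball /= rhoE opprB addrC addrA subrK.
    by rewrite exprN1 ler_pdivlMl// residue_cardR_gt0.
  have z0 : z ^ (-1) != 0 by rewrite expfz_neq0// (uniformizer_neq0 wz).
  apply/ffunP => k; apply/val_inj/sinj; rewrite ?ltn_ord//.
  pose e l := oapp (fun l : 'I_n => s (a l) - s (a' l)) 0 (insub l).
  have eE (l : 'I_n) : e l = s (a l) - s (a' l) by rewrite /e valK.
  rewrite -eE; apply: fr (ltn_ord k) => [l ln|].
    by rewrite (eE (Ordinal ln)); apply: vgeB; exact: s0.
  exists (z ^ (-1) *: (t a - t a')) => //.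
  rewrite scalerA -[z in z * _]expr1z -expfzDr ?(uniformizer_neq0 wz)//.
  rewrite subrr expr0z scale1r /t -sumrB; apply: eq_bigr => l _.
  by rewrite eE scalerBl.
Qed.

Lemma mu_ball (i : int) : mu (ball (rho i)) = (c ^ (n%:Z * i))%:E.
Proof.
have cn0 : 0 < c ^+ n by rewrite exprn_gt0// residue_cardR_gt0.
have cc0 := residue_cardR_neq0 R c0.
elim/int_ind: i => [|i IH|i IH].
- by rewrite expr0z mulr1 mulr0 expr0z; exact: (proj2 haar_mu).
- rewrite mu_ball_step (_ : i.+1%:Z - 1 = i%:Z); last by lia.
  rewrite IH -EFinM exprnP -expfzDr//; congr (_ ^ _)%:E; lia.
- have := mu_ball_step (- i%:Z); rewrite IH (_ : - i%:Z - 1 = - i.+1%:Z); last by lia.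
  move=> /(congr1 (fun x => ((c ^+ n)^-1%:E * x)%E)).
  rewrite muleA -!EFinM mulVf ?gt_eqF// mul1e => <-.
  rewrite exprnN -expfzDr//; congr (_ ^ _)%:E; lia.
Qed.

Section Points.
Variables (L : zmodType) (j : L -> V) (nm : L -> R).
Hypothesis jB : forall l l', j (l - l') = j l - j l'.
Hypothesis Nj : forall l, N (j l) = nm l.
Hypothesis nm_eq0 : forall l, nm l = 0 -> l = 0.
Hypothesis nm_finite : forall rho : R, finite_set [set l | nm l <= rho].
Variable i0 : int.
Hypothesis cover : forall x, exists l, N (x - j l) <= rho i0.

Local Notation count i := (#|` fset_set [set l : L | nm l <= rho i] |%:R : R).

Lemma points_inj : injective j.
Proof.
move=> l l' ll'; apply/eqP; rewrite -subr_eq0; apply/eqP/nm_eq0.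
by rewrite -Nj jB ll' subrr.
Qed.

Lemma points0 : j 0 = 0.
Proof. by rewrite -(subrr 0) jB subrr. Qed.

Lemma count_gt0 i : 0 < count i.
Proof.
rewrite ltr0n cardfs_gt0; apply/fset0Pn; exists 0; rewrite in_fset_set//.
by rewrite inE /= -Nj points0 N0 ltW// radius_gt0.
Qed.

Lemma points_countable : countable (range j).
Proof.
apply: (sub_countable (card_image_le j setT)).
have -> : [set: L] = \bigcup_(m in [set: nat]) [set l | nm l <= m%:R].
  apply/seteqP; split=> // l _; exists (Num.Def.archi_bound `|nm l|) => //=.
  by apply/ltW/(le_lt_trans (ler_norm _))/archi_boundP.
apply: bigcup_countable => // m _; exact: finite_set_countable.
Qed.

(** Only finitely many points have norm at most [r], so some [r * c ^ (- m)] lies below all nonzero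
    norms. *)
Lemma points_discrete : exists i1 : int, i1 <= i0 /\
  forall l, nm l <= rho i1 -> l = 0.
Proof.
have [m hm] : exists m : nat, forall l, l \in fset_set [set l | nm l <= r] ->
    l != 0 -> r < c ^+ m * nm l.
  suff fin (E : seq L) : exists m : nat, forall l, l \in E ->
    l != 0 -> r < c ^+ m * nm l by exact: fin.
  elim: E => [|l E [m hm]]; first by exists 0%N.
  have [m1 h1] := residue_card_pow_large c0 (r / nm l).
  have c1 : 1 <= c by rewrite ltW// residue_cardR_gt1.
  exists (maxn m m1) => l'; rewrite inE => /predU1P[->|l'E] l0.
    have nl : 0 < nm l.
      rewrite lt_neqAle -Nj (norm_ge0 normN) andbT eq_sym Nj.
      by apply/eqP => /nm_eq0 /eqP; rewrite (negPf l0).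
    by rewrite -ltr_pdivrMr//; apply: lt_le_trans h1 _; rewrite ler_weXn2l// leq_maxr.
  apply: lt_le_trans (hm _ l'E l0) _; rewrite ler_wpM2r//.
    by rewrite -Nj (norm_ge0 normN).
  by rewrite ler_weXn2l// leq_maxl.
exists (Num.min i0 (- m%:Z)); rewrite ge_min lexx; split=> // l hl.
have hl' : nm l <= rho (- m%:Z).
  by apply: le_trans hl (radius_le _); rewrite ge_min lexx orbT.
apply: contrapT => /eqP l0.
have := hm l; rewrite in_fset_set// inE/= => /(_ _ l0) h.
have : r < c ^+ m * nm l.
  apply: h; apply: le_trans hl' _.
  rewrite -[leRHS]mulr1 -[X in _ <= r * X](expr0z c).
  by apply: radius_le; lia.
rewrite ltNge => /negP; apply.
by rewrite -ler_pdivlMl ?exprn_gt0 ?residue_cardR_gt0// mulrC exprnN.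
Qed.

Let G : set V := range j.

Let subgroup0 : G 0. Proof. by exists 0 => //; exact: points0. Qed.

Let subgroupB (x y : V) : G x -> G y -> G (x - y).
Proof. by move=> [l _ <-] [l' _ <-]; exists (l - l'). Qed.

Lemma covolume_lower i (D : set (borel N)) : fundamental_domain G D ->
  ((c ^ (n%:Z * i) / count i)%:E <= mu D)%E.
Proof.
move=> domD; rewrite [X in X%:E]mulrC EFinM lee_pdivrMl ?count_gt0// -mu_ball.
apply: (mu_ball_le_domain (t := j) N0 NB mu_shift subgroup0 subgroupB) => //.
  exact: radius_gt0.
  exact: points_countable.
by move=> _ [[l _ <-] hl]; exists l => //=; rewrite -Nj.
Qed.

Lemma covolume_upper i : i0 <= i -> exists2 D : set (borel N),
  fundamental_domain G D & (mu D <= (c ^ (n%:Z * i) / count i)%:E)%E.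
Proof.
move=> i0i; have [i1 [i1i0 disc]] := points_discrete.
have [|||||||D domD hD] := @domain_in_ball R V N N0 NB mu mu_shift G subgroup0 subgroupB
    (rho i) (rho i1) L [set l | nm l <= rho i] j.
- exact: radius_gt0.
- by apply: radius_le; exact: le_trans i0i.
- by move=> _ [l _ <-]; rewrite Nj => /disc ->; exact: points0.
- move=> x; have [l hl] := cover x; exists (j l); first by exists l.
  exact: le_trans hl (radius_le i0i).
- exact: nm_finite.
- by move=> l /= hl; rewrite Nj; split=> //; exists l.
- by move=> l l' _ _; exact: points_inj.
exists D => //; rewrite [X in X%:E]mulrC EFinM lee_pdivlMl ?count_gt0//.
by rewrite -mu_ball.
Qed.

(** The two bounds agree for [i0 <= i]. In particular [vol] is finite and positive, so the extended
    division is that of the reals and the lower bounds can be inverted. *)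
Lemma count_covolume : let vol : \bar R := covolume mu G in
  (forall i : int, i0 <= i -> (count i)%:E = ((c ^ (n%:Z * i))%:E / vol)%E) /\
  (forall i : int, ((c ^ (n%:Z * i))%:E / vol <= (count i)%:E)%E).
Proof.
move=> vol.
have volge i : ((c ^ (n%:Z * i) / count i)%:E <= vol)%E.
  by apply: le_ereal_inf_tmp => _ [D domD <-]; exact: covolume_lower.
have volE i : i0 <= i -> vol = (c ^ (n%:Z * i) / count i)%:E.
  move=> /covolume_upper[D domD hD]; apply/eqP; rewrite eq_le volge andbT.
  by apply: ge_ereal_inf; exists (mu D) => //; exists D.
have cpos i : 0 < c ^ (n%:Z * i) by rewrite exprz_gt0// residue_cardR_gt0.
have vpos i : 0 < c ^ (n%:Z * i) / count i by rewrite divr_gt0 ?count_gt0.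
have divE i (a : R) : 0 < a -> ((c ^ (n%:Z * i))%:E / a%:E = (c ^ (n%:Z * i) / a)%:E)%E.
  by move=> a0; rewrite inver gt_eqF.
split=> i.
  move=> i0i; rewrite (volE i i0i) divE//; congr _%:E.
  by rewrite invf_div mulrCA divff ?mulr1// gt_eqF.
have := volge i; rewrite (volE i0 (lexx _)) divE; last exact: vpos.
rewrite !lee_fin => h; rewrite ler_pdivrMr; last exact: vpos.
by rewrite [leRHS]mulrC -ler_pdivrMr//; exact: count_gt0.
Qed.

End Points.
End LatticePoints.

(** * The zero space *)

Section ZeroSpace.
Variables (R : realType) (V : zmodType) (N : V -> R) (V0 : forall x : V, x = 0).
Hypothesis N0 : N 0 = 0.
Variables (r : R) (r_gt0 : 0 < r) (mu : {measure set (borel N) -> \bar R}).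
Hypothesis haar_mu : normalized_haar r mu.

Lemma zero_space_covolume (G : set V) : G 0 -> covolume mu G = 1%E.
Proof.
move=> subgroup0; have ballT : [set x | N x <= r] = setT.
  by apply/seteqP; split=> // x _ /=; rewrite (V0 x) N0 ltW.
have muT : mu setT = 1%E by rewrite -ballT; exact: (proj2 haar_mu).
rewrite /covolume (_ : fundamental_domain G = [set setT]).
  by rewrite image_set1 muT ereal_inf1.
apply/seteqP; split=> D /=.
  move=> [_ /(_ 0)[g [[_ Dg] _]]]; apply/seteqP; split=> // x _.
  by rewrite (V0 x) -(V0 (0 - g)).
move=> ->; split=> // x; exists 0; split=> // g _; exact: esym (V0 g).
Qed.

End ZeroSpace.

(** Rounding the coefficients of [x] on generators of [L] to elements of [A] leaves a remainder of
    norm at most [c ^ m * M]. *)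
Lemma lattice_cover (R : realType) (F : fieldType) (v : dvaluation F)
    (Fv : fieldType) (w : dvaluation Fv) (iota : {rmorphism F -> Fv})
    (L : lmodType (regular_ring v)) (V : lmodType Fv)
    (j : {linear L -> V | regular_to v iota \; *:%R})
    (N : V -> R) (normN : ultrametric_norm (vabs R w) N)
    (c0 : residue_card w != 0%N) (r : R) (r_gt0 : 0 < r) (s : seq L) (m : nat) :
  (forall x : Fv, exists a : regular_ring v, vge w (- m%:Z) (x - iota (val a))) ->
  (forall x, exists a : 'I_(size s) -> Fv, x = \sum_(t < size s) a t *: j s`_t) ->
  exists i : int, forall x, exists l, N (x - j l) <= r * (residue_card w)%:R ^ i.
Proof.
move=> cocompact span; set c : R := (residue_card w)%:R.
have cge0 : 0 <= c by exact: ltW (residue_cardR_gt0 R c0).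
pose M := \sum_(t < size s) N (j s`_t).
have Mge t : N (j s`_(t : 'I_(size s))) <= M.
  rewrite /M (bigD1 t)//= lerDl sumr_ge0// => t' _; exact: norm_ge0 normN _.
have M0 : 0 <= M by apply: sumr_ge0 => t _; exact: norm_ge0 normN _.
have [i hi] := residue_card_pow_large c0 (c ^ m * M / r).
exists i => x; have [a ->] := span x.
have /choice[q hq] : forall t, exists q : regular_ring v,
    vge w (- m%:Z) (a t - iota (val q)) by move=> t; exact: cocompact.
exists (\sum_(t < size s) q t *: s`_t); rewrite linear_sum -sumrB.
apply: (@le_trans _ _ (c ^ m * M)); last first.
  by rewrite -ler_pdivrMl// [leLHS]mulrC ltW.
apply: (norm_sum_le normN) => [|t _]; first by rewrite mulr_ge0// exprz_ge0.
rewrite linearZ/= -scalerBl.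
by have := normZ_le normN c0 (hq t) (Mge t); rewrite opprK.
Qed.

Theorem theorem1p18 (R : realType) (k : finFieldType)
    (F : fieldExtType {fraction {poly k}}) (v : dvaluation F)
    (Fv : fieldType) (w : dvaluation Fv) (iota : {rmorphism F -> Fv})
    (completion_w : is_completion v w iota)
    (L : lmodType (regular_ring v)) (nm : L -> R)
    (lattice_L : is_lattice w iota nm)
    (n : nat) (rank_L : has_rank L n)
    (V : lmodType Fv) (j : {linear L -> V | regular_to v iota \; *:%R})
    (tensor_V : is_base_change j)
    (N : V -> R) (norm_N : ultrametric_norm (vabs R w) N)
    (N_ext : forall l : L, N (j l) = nm l)
    (r : R) (r_gt0 : 0 < r)
    (mu : {measure set (borel N) -> \bar R}) (haar_mu : normalized_haar r mu) :
  let c : R := (residue_card w)%:R in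
  let count (i : int) : R :=
    #|` fset_set [set l : L | nm l <= r * c ^ i] |%:R in
  let vol : \bar R := covolume mu (range j) in
  (exists i0 : int, forall i : int, i0 <= i ->
     (count i)%:E = ((c ^ (n%:Z * i))%:E / vol)%E) /\
  (forall i : int, ((c ^ (n%:Z * i))%:E / vol <= (count i)%:E)%E).
Proof.
move=> c count vol.
have [fgL _ [_ nm_eq0 _ _] nm_finite] := lattice_L.
have [b [H [bE Hb spanL]]] := base_change_basis tensor_V rank_L.
have nm0 l : nm l = 0 -> l = 0 by case: (nm_eq0 l).
have [[x0 x0n0]|V0] := pselect (exists x : V, x != 0).
  have c0 := residue_card_neq0 norm_N x0n0.
  have [m hm] := completion_cocompact completion_w c0.
  have [s hs] := spanL fgL.
  have [i0 cover] := lattice_cover norm_N c0 r_gt0 hm hs.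
  have [_ _ K_complete] := completion_w.
  have [h1 h2] := count_covolume norm_N c0 K_complete bE Hb r_gt0 haar_mu
    (raddfB j) N_ext nm0 nm_finite cover.
  by split; [exists i0|].
have {}V0 (x : V) : x = 0.
  by apply/eqP/negPn/negP => x0; apply: V0; exists x.
(* With [n > 0] the vector [b ord0] would be 0 while its coordinates are not. *)
have n0 : n = 0%N.
  case: n b H bE Hb {rank_L spanL} => // n b H _ Hb.
  have /eqP := Hb ord0; rewrite (V0 (b ord0)) linear0 => /eqP /rowP /(_ ord0).
  by rewrite !mxE !eqxx => /eqP; rewrite eq_sym oner_eq0.
have -> : vol = 1%E.
  apply: (zero_space_covolume V0 (norm0 norm_N) r_gt0 haar_mu).
  by exists 0 => //; rewrite raddf0.
have count1 i : count i = 1.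
  rewrite /count (_ : [set l | _] = [set 0]) ?fset_set1 ?cardfs1//.
  apply/seteqP; split=> l /=.
    by move=> _; apply: nm0; rewrite -N_ext (V0 (j l)) (norm0 norm_N).
  move=> ->; rewrite -N_ext raddf0 (norm0 norm_N); apply: mulr_ge0; first exact: ltW.
  by apply: exprz_ge0; exact: ler0n.
have divE i : ((c ^ (n%:Z * i))%:E / 1 = 1)%E.
  by rewrite n0 mul0r expr0z inver oner_eq0 invr1 mule1.
split; first by exists 0 => i _; rewrite count1 divE.
by move=> i; rewrite count1 divE.
Qed.
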